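(* Let $G$ be a group. Then $G$ admits presentation by a finite convergent length-reducing rewriting system $(\Sigma, T)$ such that $\Sigma=\Sigma^{-1}$ and the left-hand side of every rule has length at most three if and only if $G$ is plain.
   Context: A rewriting system is a pair $(\Sigma,T)$ where $\Sigma$ is a nonempty alphabet and $T\subseteq \Sigma^*\times\Sigma^*$ is a set of rules $(\ell,r)$. It determines the relation $u\ell v\to urv$ for $(\ell,r)\in T$; $\overset{*}{\to}$ is its reflexive transitive closure, and $\overset{*}{\leftrightarrow}$ its reflexive, symmetric, transitive closure. The monoid presented is $\Sigma^*/\overset{*}{\leftrightarrow}$ under concatenation; if every class has an inverse it is a group, the group presented by $(\Sigma,T)$. The system is finite if $\Sigma$ and $T$ are finite; length-reducing if $|\ell|>|r|$ for all $(\ell,r)\in T$; terminating if there is no infinite sequence of rewrites; confluent if whenever $w\overset{*}{\to}x$ and $w\overset{*}{\to}y$ there is $z$ with $x\overset{*}{\to}z$ and $y\overset{*}{\to}z$; convergent if terminating and confluent. The condition $\Sigma=\Sigma^{-1}$ means the alphabet is closed under inverses: for each letter there is a letter of $\Sigma$ representing its inverse in $G$. A group is plain if it is isomorphic to a free product of finitely many factors, each a finite group or an infinite cyclic group. *)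

(* Defs.v *)
From mathcomp Require Import all_boot.
From Stdlib Require List.
Set Implicit Arguments. Unset Strict Implicit. Unset Printing Implicit Defensive.

Record is_group (G : Type) (mul : G -> G -> G) (one : G) (inv : G -> G) : Prop :=
  { g_assoc : forall x y z, mul x (mul y z) = mul (mul x y) z;
    g_mul1 : forall x, mul one x = x;
    g_mul1r : forall x, mul x one = x;
    g_mulV : forall x, mul (inv x) x = one;
    g_mulVr : forall x, mul x (inv x) = one }.

Section Rewriting.
Variable Sigma : finType.
Variable T : seq (seq Sigma * seq Sigma).

Definition rstep (x y : seq Sigma) : Prop :=
  exists u v l r, (l, r) \in T /\ x = u ++ l ++ v /\ y = u ++ r ++ v.

Inductive rstar : seq Sigma -> seq Sigma -> Prop :=
  | rstar_refl x : rstar x x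
  | rstar_step x y z : rstep x y -> rstar y z -> rstar x z.

Inductive rconv : seq Sigma -> seq Sigma -> Prop :=
  | rconv_refl x : rconv x x
  | rconv_fwd x y z : rstep x y -> rconv y z -> rconv x z
  | rconv_bwd x y z : rstep y x -> rconv y z -> rconv x z.

Definition length_reducing : Prop :=
  forall l r, (l, r) \in T -> size r < size l.

Definition lhs_at_most_three : Prop :=
  forall l r, (l, r) \in T -> size l <= 3.

Definition terminating : Prop :=
  ~ exists f : nat -> seq Sigma, forall n, rstep (f n) (f n.+1).

Definition confluent : Prop :=
  forall w x y, rstar w x -> rstar w y -> exists z, rstar x z /\ rstar y z.

Definition convergent : Prop := terminating /\ confluent.
End Rewriting.

(* (Sigma, T) presents the group G: the monoid Sigma^* / <-*-> is isomorphic
   to G, i.e. there is a surjective monoid morphism pi : Sigma^* -> G whose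
   kernel congruence is exactly <-*->.  Sigma = Sigma^{-1}: every letter has
   a letter representing its inverse in G. *)
Definition presents (G : Type) (mul : G -> G -> G) (one : G)
  (Sigma : finType) (T : seq (seq Sigma * seq Sigma)) (pi : seq Sigma -> G) : Prop :=
  [/\ pi [::] = one,
      (forall u v, pi (u ++ v) = mul (pi u) (pi v)),
      (forall g, exists w, pi w = g) &
      (forall u v, pi u = pi v <-> rconv T u v)].

Definition admits_fclr3_presentation (G : Type) (mul : G -> G -> G) (one : G) : Prop :=
  exists (Sigma : finType) (T : seq (seq Sigma * seq Sigma)) (pi : seq Sigma -> G),
    [/\ 0 < #|Sigma| /\ presents mul one T pi,
        (forall a : Sigma, exists b : Sigma, mul (pi [:: a]) (pi [:: b]) = one),
        length_reducing T,
        lhs_at_most_three T &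
        convergent T].

Section Plain.
Variables (G : Type) (mul : G -> G -> G) (one : G) (inv : G -> G).

Fixpoint gpow (g : G) (k : nat) : G :=
  match k with 0 => one | k'.+1 => mul g (gpow g k') end.

Definition is_subgroup (H : G -> Prop) : Prop :=
  [/\ H one, (forall x y, H x -> H y -> H (mul x y)) & (forall x, H x -> H (inv x))].

Definition finite_subgroup (H : G -> Prop) : Prop :=
  is_subgroup H /\ exists s : seq G, forall h, H h <-> List.In h s.

Definition infinite_cyclic_subgroup (H : G -> Prop) : Prop :=
  exists g, (forall h, H h <-> exists k, h = gpow g k \/ h = inv (gpow g k))
            /\ (forall k, gpow g k.+1 <> one).

Fixpoint wprod (w : seq (nat * G)) : G :=
  match w with [::] => one | (i, h) :: w' => mul h (wprod w') end.

Fixpoint reduced (n : nat) (H : nat -> G -> Prop) (w : seq (nat * G)) : Prop :=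
  match w with
  | [::] => True
  | (i, h) :: w' =>
      [/\ i < n, H i h, h <> one,
          (match w' with [::] => True | (j, _) :: _ => i <> j end) &
          reduced n H w']
  end.

(* G is the (internal) free product of the subgroups H 0, ..., H (n-1):
   every element is uniquely a reduced word (normal form theorem). *)
Definition free_product_of (n : nat) (H : nat -> G -> Prop) : Prop :=
  forall g, exists w, [/\ reduced n H w, wprod w = g &
                         forall w', reduced n H w' -> wprod w' = g -> w' = w].

Definition plain : Prop :=
  exists (n : nat) (H : nat -> G -> Prop),
    (forall i, i < n -> finite_subgroup (H i) \/ infinite_cyclic_subgroup (H i))
    /\ free_product_of n H.
End Plain.

(* Main.v *)
Require Import Defs.
From mathcomp Require Import all_boot.
From mathcomp Require Import zify.
From mathcomp Require Import boolp.
Set Implicit Arguments. Unset Strict Implicit. Unset Printing Implicit Defensive.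

(* Let (Sigma, T) be as in the theorem.  Irreducible words are exactly the
   geodesics of the Cayley graph, so that graph has unique geodesics, and a path
   is geodesic as soon as all its subpaths of length three are.  In such a graph,
   removing a vertex [p] leaves two neighbours of [p] connected only if they
   are equal, adjacent, or lie with [p] on an isometric pentagon; it follows that
   two vertices at distance at least three are separated by a vertex, so every
   block is finite, of diameter at most two.  The elements sharing a block with
   the identity form a finite groupoid whose objects are the blocks at the
   identity, and every group element is uniquely a product of pairwise
   unmergeable such elements.  A free basis adapted to this groupoid (one finite
   vertex group per component and one infinite cyclic factor for each further
   object) shows that the group is plain.
   Conversely, take as letters the nontrivial elements of the finite factors and
   the generators, with inverses, of the cyclic ones, and as rules all the
   shortenings of words of length at most two. *)

(** * Geodetic graphs whose local 3-geodesics are geodesics *)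

Section Geodetic.
Variables (V : Type) (d : V -> V -> nat).

(** The fourth clause is uniqueness of geodesics, stated through the last vertex before [y]. By the
    fifth, a geodesic ending in [u], [v], [z] extends by [z'] as soon as [u], [v], [z], [z'] is
    itself a geodesic. *)
Definition geodetic_local3 : Prop :=
  [/\ (forall x y, d x y = 0 <-> x = y) /\ (forall x y, d x y = d y x),
      forall x y z, d x z <= d x y + d y z,
      forall x y n, d x y = n.+1 -> exists z, d x z = n /\ d z y = 1,
      forall x y z z', d x y = (d x z).+1 -> d z y = 1 ->
         d x y = (d x z').+1 -> d z' y = 1 -> z = z' &
      forall x u v z z', d u v = 1 -> d v z = 1 -> d z z' = 1 ->
         d x z = (d x u).+2 -> d u z' = 3 -> d x z' = (d x u).+3].

Inductive joined (v : V) : V -> V -> Prop :=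
  | joined_refl x : x <> v -> joined v x x
  | joined_step x y z : x <> v -> d x y = 1 -> joined v y z -> joined v x z.

Hypothesis Hd : geodetic_local3.

Let d0 x y : d x y = 0 <-> x = y. Proof. by case: Hd => -[]. Qed.
Let dxx x : d x x = 0. Proof. exact/d0. Qed.
Let dC x y : d x y = d y x. Proof. by case: Hd => -[]. Qed.
Let dtri x y z : d x z <= d x y + d y z. Proof. by case: Hd. Qed.
Let dpred x y n : d x y = n.+1 -> exists z, d x z = n /\ d z y = 1.
Proof. by case: Hd => ? ? + _ _; apply. Qed.

(** * Uniqueness and prolongation of short geodesics *)

Lemma two_path_unique a b b' c : d a c = 2 ->
  d a b = 1 -> d b c = 1 -> d a b' = 1 -> d b' c = 1 -> b = b'.
Proof. by case: Hd => _ _ _ U _ ac ab bc ab' bc'; apply: (U a c); lia. Qed.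

Lemma three_path_unique a b c b' c' e : d a e = 3 ->
  d a b = 1 -> d b c = 1 -> d c e = 1 ->
  d a b' = 1 -> d b' c' = 1 -> d c' e = 1 -> b = b' /\ c = c'.
Proof.
case: (Hd) => _ _ _ U _ ae ab bc ce ab' bc' ce'.
have := dtri a b c; have := dtri a c e; have := dtri a b' c'; have := dtri a c' e.
move=> *; have cc : c = c' by apply: (U a e); lia.
by subst c'; split=> //; apply: (@two_path_unique a _ _ c) => //; lia.
Qed.

Lemma four_path_unique a b c e b' c' e' f : d a f = 4 ->
  d a b = 1 -> d b c = 1 -> d c e = 1 -> d e f = 1 ->
  d a b' = 1 -> d b' c' = 1 -> d c' e' = 1 -> d e' f = 1 -> c = c'.
Proof.
case: (Hd) => _ _ _ U _ af ab bc ce ef ab' bc' ce' ef'.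
have := dtri a b c; have := dtri a c e; have := dtri a e f.
have := dtri a b' c'; have := dtri a c' e'; have := dtri a e' f.
move=> *; have ee : e = e' by apply: (U a f); lia.
subst e'; have [] // := @three_path_unique a b c b' c' e; lia.
Qed.

Lemma four_path a b c e f : d a b = 1 -> d b c = 1 -> d c e = 1 -> d e f = 1 ->
  d a e = 3 -> d b f = 3 -> d a f = 4.
Proof.
case: (Hd) => _ _ _ _ L ab bc ce ef ae bf.
by rewrite (L a b c e f) ?ab.
Qed.

(** The 5-cycle [p], [a], [z], [z'], [b]; its two edges at [p] are hypotheses of the lemmas that use
    it. *)
Definition pentagon p a b := d a b = 2 /\ exists z z',
  [/\ d a z = 1, d z z' = 1, d z' b = 1, d p z = 2 & d p z' = 2].

Definition linked p a b := a = b \/ d a b = 1 \/ pentagon p a b.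

Lemma linked_sym p a b : linked p a b -> linked p b a.
Proof.
move=> [->|[ab|[ab [z [z' [az zz zb pz pz']]]]]]; first by left.
  by right; left; rewrite dC.
right; right; split; first by rewrite dC.
by exists z', z; split; rewrite // dC.
Qed.

(** Otherwise [p] and [b] would be two midpoints of [a] and [c]. *)
Lemma neighbour_clique p a b c : d p a = 1 -> d p b = 1 -> d p c = 1 ->
  d a b = 1 -> d b c = 1 -> d a c <= 1.
Proof.
move=> pa pb pc ab bc.
case: (leqP (d a c) 1) => // ac; have := dtri a p c; rewrite (dC a p) => ac2.
have pb' : p = b by apply: (@two_path_unique a _ _ c) => //; rewrite ?(dC a p); lia.
by subst p; rewrite dxx in pb.
Qed.

(** The missing vertex is the midpoint of [z] and [c]. If it were adjacent to [p], it would be [a],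
    the only midpoint of [p] and [z], which is not adjacent to [c]. *)
Lemma pentagon_close p a c z : d p a = 1 -> d p c = 1 -> d a c = 2 ->
  d a z = 1 -> d p z = 2 -> d z c <= 2 -> pentagon p a c.
Proof.
move=> pa pc ac az pz zc2; have nac : a <> c by move=> e; subst c; rewrite dxx in ac.
have mid w : d p w = 1 -> d w z = 1 -> w = a.
  by move=> pw wz; apply: (@two_path_unique p _ _ z).
have [|[|zc]] : d z c = 0 \/ d z c = 1 \/ d z c = 2 by lia.
- by move/d0=> e; subst z; lia.
- by rewrite dC => cz; case: nac; rewrite (mid c).
have [w [zw wc]] := dpred zc.
split=> //; exists z, w; split=> //.
have := dtri p c w; rewrite (dC c w).
have [|[|]] : d p w = 0 \/ d p w = 1 \/ 2 <= d p w by lia.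
- by move/d0=> e; subst w; rewrite dC in zw; lia.
- move=> pw _; have e : w = a by apply: mid; rewrite // dC.
  by subst w; rewrite wc in ac.
by rewrite pc wc; lia.
Qed.

(** If [z] and [c] were at distance three, [z], [z'], [b], [c] and [z], [a], [p], [c] would be two
    geodesics; so [pentagon_close] applies. *)
Lemma pentagon_adj p a b c : d p a = 1 -> d p b = 1 -> d p c = 1 ->
  pentagon p a b -> d b c = 1 -> pentagon p a c.
Proof.
move=> pa pb pc [ab [z [z' [az zz zb pz pz']]]] bc.
have ac : d a c = 2.
  have := dtri a p c; rewrite (dC a p).
  have [|[|]] : d a c = 0 \/ d a c = 1 \/ 2 <= d a c by lia.
  - by move/d0=> e; subst c; rewrite dC in bc; lia.
  - move=> ac _; have := @neighbour_clique p a c b pa pc pb ac.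
    by rewrite dC bc; lia.
  lia.
apply: (pentagon_close pa pc ac az pz).
case: (leqP (d z c) 2) => // zc.
have := dtri z z' c; have := dtri z' b c => *.
have [] // := @three_path_unique z z' b a p c; rewrite ?(dC z a) ?(dC a p) //; try lia.
by move=> e; subst z'; lia.
Qed.

(* The two sides of a pair of pentagons sharing the edge [p b] would otherwise
   be two geodesics of length four. *)
Lemma pentagon_trans p a b c : d p a = 1 -> d p b = 1 -> d p c = 1 ->
  pentagon p a b -> pentagon p b c -> d a c = 2 -> pentagon p a c.
Proof.
move=> pa pb pc [ab [z [z' [az zz zb pz pz']]]] [bc [w' [w [bw ww wc pw' pw]]]] ac.
case: (leqP (d z c) 2) => [|zc]; first exact: pentagon_close az pz.
case: (leqP (d w a) 2) => [wa|wa].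
  have L : linked p c a.
    by right; right; apply: (pentagon_close pc pa _ _ pw wa); rewrite dC.
  have [e|[e|//]] := linked_sym L; last by rewrite e in ac.
  by subst c; rewrite dxx in ac.
have zc3 : d z c = 3.
  have := dtri z a c; have := dtri a p c; rewrite (dC z a) (dC a p); lia.
have wa3 : d a w = 3.
  have := dtri a p w; rewrite (dC w a) (dC a p) in wa *; lia.
have zw : d z w = 4.
  by apply: (@four_path z a p c w); rewrite // 1?(dC z a) 1?(dC a p) 1?(dC c w).
have e : p = b.
  by apply: (@four_path_unique z a p c z' b w' w);
    rewrite // 1?(dC z a) 1?(dC a p) 1?(dC c w).
by subst p; rewrite dxx in pb.
Qed.

Lemma linked_trans p a b c : d p a = 1 -> d p b = 1 -> d p c = 1 ->
  linked p a b -> linked p b c -> linked p a c.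
Proof.
move=> pa pb pc ab bc.
have [|[|]] : d a c = 0 \/ d a c = 1 \/ d a c = 2.
- have := dtri a p c; rewrite (dC a p); lia.
- by move/d0; left.
- by right; left.
move=> ac; case: (ab) => [->//|]; case: (bc) => [<-//|].
move=> [bc1|bc1] [ab1|ab1].
- by right; left; have := neighbour_clique pa pb pc ab1 bc1; lia.
- by right; right; apply: pentagon_adj bc1.
- apply: linked_sym; right; right; apply: (@pentagon_adj p c b a) => //.
    have [e|[cb|//]] := linked_sym bc; first by subst c; case: bc1; rewrite dxx.
    by case: bc1; rewrite dC cb.
  by rewrite dC.
by right; right; apply: pentagon_trans bc1 ac.
Qed.

(** * First steps of geodesics, and paths avoiding a vertex *)

Definition first_step p a z := d p a = 1 /\ d p z = (d a z).+1.

Lemma first_step_ex p z : z <> p -> exists a, first_step p a z.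
Proof.
move=> zp; case E: (d z p) => [|n]; first by move/d0: E.
have [a [za ap]] := dpred E.
by exists a; split; [rewrite dC | rewrite dC E (dC a) za].
Qed.

Lemma first_step_unique p a b z : first_step p a z -> first_step p b z -> a = b.
Proof.
move=> [pa paz] [pb pbz]; case: Hd => _ _ _ U _.
by apply: (U z p); rewrite ?(dC z) ?(dC a p) ?(dC b p).
Qed.

(** Unless [a = b], the vertices [z] and [z'] are equally far from [p], while [z'] is one further
    from [a] than [z]. If [a] and [z] are at least two apart, the local condition prolongs the
    geodesic from [p] through [z] to [z'], a contradiction. Distance zero gives an edge, distance
    one a pentagon. *)
Lemma first_step_linked p a b z z' : first_step p a z -> first_step p b z' ->
  d z z' = 1 -> linked p a b.
Proof.
wlog le : a b z z' / d p z <= d p z'.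
  move=> H az bz zz; have /orP[le|le] := leq_total (d p z) (d p z').
    exact: (H a b z z').
  by apply/linked_sym/(H b a z' z) => //; rewrite dC.
move=> az bz zz; have [pa paz] := az; have [pb pbz] := bz.
have same : d a z' < d p z' -> linked p a b.
  move=> lt; left; apply: first_step_unique bz; split=> //.
  have := dtri p a z'; lia.
case: (ltnP (d a z') (d p z')) => // az'.
have t1 := dtri a z z'.
have [m0|[m1|[m Em]]] : d a z = 0 \/ d a z = 1 \/ exists m, d a z = m.+2.
  by case: (d a z) => [|[|m]]; [left|right;left|right;right; exists m].
- have e : a = z by apply/d0.
  have e' : b = z' by apply/d0; lia.
  by subst z z'; right; left.
- case/boolP: (d a b == 0) => [/eqP/d0|ab0]; first by left.
  case/boolP: (d a b == 1) => [/eqP|ab1]; first by right; left.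
  right; right; split; first by have := dtri a p b; rewrite (dC a p); lia.
  by exists z, z'; split=> //; [rewrite dC|..]; lia.
have [v [av vz]] := dpred Em; have [u [au uv]] := dpred av.
have pu : d p u = m.+1.
  have := dtri p a u; have := dtri p u z; have := dtri u v z; lia.
have := dtri u v z'; have := dtri v z z'; have := dtri a u z' => *.
case: Hd => _ _ _ _ /(_ p u v z z' uv vz zz); lia.
Qed.

Lemma joined_start v x y : joined v x y -> x <> v.
Proof. by case. Qed.

Lemma joined_trans v x y z : joined v x y -> joined v y z -> joined v x z.
Proof. by elim=> // a b c nv ab _ IH /IH; apply: joined_step. Qed.

Lemma joined_sym v x y : joined v x y -> joined v y x.
Proof.
elim=> [a|a b c nv ab bc IH]; first exact: joined_refl.
apply: (joined_trans IH); apply: (@joined_step _ b a a); last exact: joined_refl.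
  exact: joined_start bc.
by rewrite dC.
Qed.

(** Consecutive vertices of a path avoiding [p] have linked first steps, and [linked p] is
    transitive on neighbours of [p]. *)
Lemma joined_linked p x y a b : joined p x y ->
  first_step p a x -> first_step p b y -> linked p a b.
Proof.
move=> J; elim: J a => [z np|z t y' np zt ty IH] a ax bx.
  by left; apply: first_step_unique ax bx.
have [c cz] := first_step_ex (joined_start ty).
apply: (@linked_trans p a c b); [by case: ax|by case: cz|by case: bx| |exact: IH].
exact: first_step_linked zt.
Qed.

(** The geodesic from [z] to [y] stays closer to [y] than [v] is. *)
Lemma joined_geodesic v z y : d z y < d v y -> joined v z y.
Proof.
move: {2}(d z y) (erefl (d z y)) => n; elim: n z => [|n IH] z E lt.
  move/d0: E => E; subst z; apply: joined_refl => e; subst v; lia.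
rewrite dC in E; have [t [yt tz]] := dpred E.
apply: (@joined_step _ z t); last by apply: IH; have := dC z y; rewrite (dC t); lia.
- by move=> e; subst v; lia.
- by rewrite dC.
Qed.

(** The pentagons [p], [q], [z], [z'], [x] and [q], [p], [w'], [w], [y] share an edge. The midpoint
    [s] of [z] and [w] is forced to be two away from [p] and three away from [x]; then it has two
    geodesics from [x], one through [z'] and [z], the other through [p]. *)
Lemma length_three_aux x p q y z z' w w' :
  d x p = 1 -> d p q = 1 -> d q y = 1 -> d x y = 3 ->
  d q z = 1 -> d z z' = 1 -> d z' x = 1 -> d p z = 2 ->
  d p w' = 1 -> d w' w = 1 -> d w y = 1 -> d q w = 2 -> d q w' = 2 ->
  d z w <= 2 -> False.
Proof.
move=> xp pq qy xy qz zz zx pz pw ww wy qw qw'.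
have nwq : w' <> q by move=> e; subst w'; rewrite dxx in qw'.
have py : d p y = 2.
  have := dtri p q y; have := dtri x p y; lia.
have xw : d x w = 3.
  have := dtri x p w; have := dtri p w' w; have := dtri x w y => *.
  have [|xw2] : d x w = 3 \/ d x w = 2 by lia.
    by [].
  have [s [xs sw]] := dpred xw2.
  have [] // := @three_path_unique x s w p q y => _ e.
  by subst w; rewrite dxx in qw.
have pw2 : d p w = 2.
  have := dtri p w' w; have := dtri x p w; lia.
have zy : 2 <= d z y.
  have [|[|//]] : d z y = 0 \/ d z y = 1 \/ 2 <= d z y by lia.
    move/d0=> e; subst z; have := dtri x z' y.
    by rewrite (dC x z') (dC z' y); lia.
  move=> zy1; have [] := @three_path_unique x z' z p q y; rewrite ?(dC x z') ?(dC z' z) //.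
  by move=> e; subst z'; rewrite dC in zz; lia.
move=> zw.
have zw2 : d z w = 2.
  have [|[|]] : d z w = 0 \/ d z w = 1 \/ 2 <= d z w by lia.
  - by move/d0=> e; subst z; lia.
  - move=> zw1.
    have e : z = y by apply: (@two_path_unique q _ _ w) => //; rewrite dC.
    by subst y; rewrite dxx in zy.
  lia.
have [s [zs sw]] := dpred zw2.
have nsw : s <> w'.
  move=> e; subst s; apply: nwq; apply: (@two_path_unique p _ _ z) => //.
  by rewrite dC.
have := dtri p w' s => psw.
have ps : d p s = 2.
  have := dtri p w s; rewrite (dC w s) => psw2.
  have [|[|[//|]]] : d p s = 0 \/ d p s = 1 \/ d p s = 2 \/ d p s = 3 by lia.
  - by move/d0=> e; subst s; lia.
  - by move=> ps1; case: nsw; apply: (@two_path_unique p _ _ w).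
  move=> ps3; case: nwq.
  by have [] := @three_path_unique p w' w q z s; rewrite // dC.
have [m [pm ms]] := dpred ps.
have [|xs] := leqP (d x s) 2.
  have := dtri x s w => *.
  have xs2 : d x s = 2 by lia.
  have [t [xt ts]] := dpred xs2.
  by have [] := @three_path_unique x t s p w' w.
have xs3 : d x s = 3 by have := dtri x p s; lia.
have [] := @three_path_unique x z' z p m s; rewrite ?(dC x z') ?(dC z' z) //.
by move=> e; subst z'; rewrite dC in zz; lia.
Qed.

(** If neither inner vertex separates the ends, each lies on a pentagon with its two neighbours on
    the path. *)
Lemma length_three_separated x p q y :
  d x p = 1 -> d p q = 1 -> d q y = 1 -> d x y = 3 ->
  joined p x y -> joined q x y -> False.
Proof.
move=> xp pq qy xy Jp Jq.
have := dtri x p y; have := dtri p q y; have := dtri x p q; have := dtri x q y => *.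
have [px qp yq] : [/\ d p x = 1, d q p = 1 & d y q = 1] by split; rewrite dC.
have : linked p q x.
  apply: (joined_linked (joined_sym Jp)); split=> //; [lia|by rewrite dxx].
case=> [e|[e|]]; first by subst q; lia.
  by rewrite dC in e; lia.
move=> [_ [z [z' [qz zz zx pz pz']]]].
have : linked q p y.
  apply: (joined_linked Jq); split=> //; rewrite ?dxx // (dC q x) (dC p x); lia.
case=> [e|[e|]]; [by subst y; lia|by lia|].
move=> [_ [w' [w [pw ww wy qw' qw]]]].
(* The two pentagons cannot come close: the second case is the first one with the path read
   backwards. *)
have [zw|zw] := leqP (d z w) 2.
  exact: (@length_three_aux x p q y z z' w w').
have [zw'|zw'] := leqP (d w' z') 2.
  by apply: (@length_three_aux y q p x w' w z' z) => //; rewrite dC.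
have := dtri z y w; have := dtri z q y; have := dtri w' p z'; have := dtri p x z'.
rewrite (dC z q) (dC w' p) (dC x z') (dC y w) => *.
have xw : d x w = 3.
  have := dtri x p w; have := dtri p w' w; have := dtri x w y => *.
  have [|xw2] : d x w = 3 \/ d x w = 2 by lia.
    by [].
  have [s [xs sw]] := dpred xw2.
  have [] // := @three_path_unique x s w p q y => _ e.
  by subst w; rewrite dxx in qw.
have zy : d z' y = 3.
  have := dtri z' z y; have := dtri z q y; have := dtri x z' y.
  rewrite (dC z' z) (dC z q) (dC x z') => *.
  have [|zy2] : d z' y = 3 \/ d z' y = 2 by lia.
    by [].
  have [s [zs sy]] := dpred zy2.
  have [] // := @three_path_unique x z' s p q y; first by rewrite dC.
  by move=> e; subst z'; rewrite dxx in pz'.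
(* Two geodesics of length four now join [z'] to [w], with midpoints [q] and [p]. *)
have zw4 : d z' w = 4.
  by apply: (@four_path z' z q y w) => //; [rewrite dC|rewrite dC|rewrite dC|lia].
have e : q = p.
  by apply: (@four_path_unique z' z q y x p w' w) => //; rewrite dC.
by subst q; rewrite dxx in pq.
Qed.

(** Only the three edges next to [x] on the geodesic matter: their far end [t] is closer to [y] than
    [p] and [q], so it stays joined to [y] when either is removed. *)
Lemma separated_far x y : 3 <= d x y ->
  exists v, [/\ v <> x, v <> y & ~ joined v x y].
Proof.
move=> far; apply: contrapT => H.
have nsep v : v <> x -> v <> y -> joined v x y.
  by move=> vx vy; apply: contrapT => J; apply: H; exists v.
case E: (d x y) far => [|[|[|n]]] // _; rewrite dC in E.
have [p [yp px]] := dpred E; have [q [yq qp]] := dpred yp; have [t [yt tq]] := dpred yq.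
have xt3 : d x t = 3.
  have := dtri x p t; have := dtri p q t; have := dtri y t x.
  rewrite (dC x p) (dC p q) (dC q t) (dC x t); lia.
have ne a b : d y a <> d y b -> a <> b by move=> H1 e; subst a.
have y0 := dxx y.
have J v : v <> x -> d y t < d y v -> joined v x t.
  move=> vx lt; have Jty : joined v t y by apply: joined_geodesic; rewrite dC (dC v).
  apply: (joined_trans _ (joined_sym Jty)); apply: nsep => //.
  by apply: ne; lia.
apply: (@length_three_separated x p q t); rewrite // 1?dC //; apply: J; try lia.
  by apply: ne; lia.
by apply: ne; lia.
Qed.
End Geodetic.

(** * Normal forms of words in a group *)

Fixpoint chain (A : Type) (valid : A -> Prop) (ok : A -> A -> Prop) (w : seq A) : Prop :=
  match w with
  | [::] => True
  | a :: w' => [/\ valid a, (match w' with [::] => True | b :: _ => ok a b end) &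
                   chain valid ok w']
  end.

Lemma In_mem (A : eqType) (x : A) s : List.In x s <-> x \in s.
Proof.
elim: s => //= a s IH; rewrite in_cons; split.
  by move=> [->|/IH->]; rewrite ?eqxx ?orbT.
by case/orP=> [/eqP->|/IH]; [left|right].
Qed.

Section Groups.
Variables (G : Type) (mul : G -> G -> G) (one : G) (inv : G -> G).
Hypothesis HG : is_group mul one inv.
Local Notation "x ** y" := (mul x y) (at level 40, left associativity).
Local Notation gpow := (gpow mul one).
Local Notation is_subgroup := (is_subgroup mul one inv).

Lemma mulgA x y z : x ** y ** z = x ** (y ** z). Proof. by rewrite (g_assoc HG). Qed.
Lemma mul1x x : one ** x = x. Proof. exact: g_mul1 HG x. Qed.
Lemma mulx1 x : x ** one = x. Proof. exact: g_mul1r HG x. Qed.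
Lemma mulVx x : inv x ** x = one. Proof. exact: g_mulV HG x. Qed.
Lemma mulxV x : x ** inv x = one. Proof. exact: g_mulVr HG x. Qed.
Lemma mulKx x y : inv x ** (x ** y) = y. Proof. by rewrite -mulgA mulVx mul1x. Qed.
Lemma mulVKx x y : x ** (inv x ** y) = y. Proof. by rewrite -mulgA mulxV mul1x. Qed.
Lemma mul_cancel x y z : x ** y = x ** z -> y = z.
Proof. by move=> E; rewrite -(mulKx x y) E mulKx. Qed.
Lemma inv_eq x y : x ** y = one -> inv x = y.
Proof. by move=> E; apply: (@mul_cancel x); rewrite mulxV. Qed.
Lemma invxK x : inv (inv x) = x. Proof. by apply: inv_eq; rewrite mulVx. Qed.
Lemma inv_mul x y : inv (x ** y) = inv y ** inv x.
Proof. by apply: inv_eq; rewrite mulgA mulVKx mulxV. Qed.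
Lemma inv_one : inv one = one. Proof. by apply: inv_eq; rewrite mul1x. Qed.
Lemma inv_neq1 x : x <> one -> inv x <> one.
Proof. by move=> x1 E; apply: x1; rewrite -(invxK x) E inv_one. Qed.
Definition groupE := (mulgA, mulKx, mulVKx, mulxV, mulVx, mul1x, mulx1, invxK, inv_mul, inv_one).

Lemma gpowD g m n : gpow g (m + n) = gpow g m ** gpow g n.
Proof. by elim: m => [|m IH] /=; rewrite ?addSn /= ?IH !groupE. Qed.

Lemma gpowV g n : gpow (inv g) n = inv (gpow g n).
Proof.
elim: n => [|n IH] /=; first by rewrite !groupE.
by rewrite IH -!inv_mul -{2}[g]mulx1 -[g ** one]/(gpow g 1) -gpowD addn1.
Qed.

Lemma cyclic_is_subgroup g :
  is_subgroup (fun h => exists k, h = gpow g k \/ h = inv (gpow g k)).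
Proof.
split; first by exists 0; left.
- move=> _ _ [a [->|->]] [b [->|->]].
  + by exists (a + b); left; rewrite gpowD.
  + case/orP: (leq_total b a) => ab.
      by exists (a - b); left; rewrite -{1}(subnK ab) gpowD !groupE.
    by exists (b - a); right; rewrite -{1}(subnK ab) gpowD !groupE.
  + case/orP: (leq_total b a) => ab.
      by exists (a - b); right; rewrite -{1}(subnKC ab) gpowD !groupE.
    by exists (b - a); left; rewrite -{1}(subnKC ab) gpowD !groupE.
  + by exists (b + a); right; rewrite gpowD !groupE.
- by move=> _ [k [->|->]]; exists k; [right|left]; rewrite ?invxK.
Qed.

Section Chains.
Variables (A : Type) (valid : A -> Prop) (ok : A -> A -> Prop) (val : A -> G).
Local Notation prod := (foldr (fun a g => val a ** g) one).
Local Notation chain := (chain valid ok).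

Lemma chain_nseq a k w : valid a -> ok a a -> chain w ->
  (match w with [::] => True | b :: _ => ok a b end) ->
  chain (nseq k.+1 a ++ w) /\ prod (nseq k.+1 a ++ w) = gpow (val a) k.+1 ** prod w.
Proof.
move=> va aa cw aw; elim: k => [|k [IH1 IH2]]; first by rewrite /= mulx1.
split; first by [].
change (val a ** prod (nseq k.+1 a ++ w) = gpow (val a) k.+2 ** prod w).
by rewrite IH2 /= !mulgA.
Qed.

(* A word is recovered from its product by stripping its first letter [b]:
   left multiplication by [b^-1] turns the chain [a :: _] into another chain. *)
Lemma chain_unique :
  (forall b, valid b -> exists b', [/\ valid b', val b' = inv (val b) & ~ ok b b']) ->
  (forall b a, valid b -> valid a ->
     [\/ exists b', [/\ valid b', val b' = inv (val b), ok b' a & ~ ok b b'],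
         a = b |
         exists c, [/\ valid c, val c = inv (val b) ** val a,
                      (forall e, valid e -> ok a e -> ok c e) & ~ ok b c]]) ->
  (forall w, chain w -> w <> [::] -> prod w <> one) ->
  forall u v, chain u -> chain v -> prod u = prod v -> u = v.
Proof.
move=> Hinv Hmul H1 u v; elim: v u => [|b v IH] u cu cv E.
  by case: u cu E => // a u cu E; case: (H1 _ cu).
case: (cv) => vb bv cv'.
have {}E : inv (val b) ** prod u = prod v by rewrite E /= !groupE.
case: u cu E => [|a u] cu E.
  have [b' [vb' Eb' nbb']] := Hinv _ vb.
  have e : [:: b'] = v by apply: IH => //=; rewrite Eb'.
  by subst v.
case: (cu) => va au cu'.
(* In the first and third cases the new chain would be [v], so its first letter could follow [b],
   against the last clause of [Hmul]. *)
have [[b' [vb' Eb' ba nbb']]|e|[c [vc Ec ce nbc]]] := Hmul b a vb va.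
- have e : [:: b', a & u] = v by apply: IH => //=; rewrite Eb'.
  by subst v.
- subst b; congr (_ :: _); apply: IH => //.
  by rewrite /= mulKx in E.
have e : c :: u = v.
  apply: IH => //; last by rewrite /= Ec mulgA.
  by split=> //; case: u au cu' {cu E} => // e u ae [ve _ _]; apply: ce.
by subst v.
Qed.
End Chains.

Lemma reduced_chain n H (w : seq (nat * G)) : reduced one n H w <->
  chain (fun a => [/\ a.1 < n, H a.1 a.2 & a.2 <> one]) (fun a b => a.1 <> b.1) w.
Proof.
elim: w => //= -[i h] w IH; split.
  move=> [hn hH h1 hw /IH cw]; split=> //=.
  by case: w hw {IH cw} => // -[].
move=> [[hn hH h1] hw /IH cw]; split=> //=.
by case: w hw {IH cw} => // -[].
Qed.

Lemma wprod_foldr (w : seq (nat * G)) :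
  wprod mul one w = foldr (fun a g => a.2 ** g) one w.
Proof. by elim: w => //= -[i h] w ->. Qed.

(** Existence: multiplying a reduced word on the left by a factor element prepends, merges or
    cancels one syllable. Uniqueness: [chain_unique] reduces it to words of value [one]. *)
Lemma free_product_of_reduced n (H : nat -> G -> Prop) :
  (forall i, i < n -> is_subgroup (H i)) ->
  (forall Q : G -> Prop, Q one ->
     (forall i h g, i < n -> H i h -> Q g -> Q (h ** g)) -> forall g, Q g) ->
  (forall w, reduced one n H w -> w <> [::] -> wprod mul one w <> one) ->
  free_product_of mul one n H.
Proof.
move=> sH gen ne g.
have : exists w, reduced one n H w /\ wprod mul one w = g.
  pose Q g := exists w, reduced one n H w /\ wprod mul one w = g.
  apply: (gen Q) => [|i h g' li Hh [w [rw <-]]]; first by exists [::].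
  rewrite /Q; have [->|h1] := EM (h = one); first by exists w; rewrite mul1x.
  have [_ sM sV] := sH i li.
  case: w rw => [|[j k] w] /=; first by exists [:: (i, h)].
  move=> [lj Hk k1 kw rw]; have [e|ij] := EM (i = j); last first.
    by exists [:: (i, h), (j, k) & w].
  subst j; have [hk|hk] := EM (h ** k = one).
    by exists w; rewrite -mulgA hk mul1x.
  exists ((i, h ** k) :: w); split; last by rewrite /= mulgA.
  by split=> //; apply: sM.
move=> [w [rw <-]]; exists w; split=> // w' rw' E.
rewrite !wprod_foldr in E.
move/reduced_chain: rw => cw; move/reduced_chain: rw' => cw'.
apply: (chain_unique (val := snd) _ _ _ cw' cw E).
- move=> [i h] /= [li Hi h1]; have [_ _ sV] := sH i li.
  by exists (i, inv h); split=> //=; split=> //; [apply: sV|apply: inv_neq1].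
- move=> [i h] [j k] /= [li Hh h1] [lj Hk k1]; have [_ sM sV] := sH i li.
  have [e|ij] := EM (i = j); last first.
    constructor 1; exists (i, inv h); split=> //=.
    by split=> //; [apply: sV|apply: inv_neq1].
  subst j; have [e|hk] := EM (inv h ** k = one).
    by constructor 2; rewrite -[k](mulVKx h) e mulx1.
  constructor 3; exists (i, inv h ** k); split=> //=.
  by split=> //; apply: sM => //; apply: sV.
by move=> u /reduced_chain cu nu; rewrite -wprod_foldr; apply: ne.
Qed.

End Groups.

(** * The groupoid of blocks *)

Section Blocks.
Variables (G : Type) (mul : G -> G -> G) (one : G) (inv : G -> G).
Hypothesis HG : is_group mul one inv.
Local Notation "x ** y" := (mul x y) (at level 40, left associativity).
Local Notation gpow := (gpow mul one).
Let gE := (groupE HG).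

Variable d : G -> G -> nat.
Hypothesis Hd : geodetic_local3 d.
Hypothesis dL : forall g x y, d (g ** x) (g ** y) = d x y.
Local Notation joined := (joined d).

(** No vertex separates [x] from [y]: they are equal or lie in a common block. *)
Definition coblock x y := forall v, v <> x -> v <> y -> joined v x y.
Definition blockelt g := g <> one /\ coblock one g.

Lemma joined_mul g v x y : joined v x y -> joined (g ** v) (g ** x) (g ** y).
Proof.
have inj a b : a <> b -> g ** a <> g ** b by move=> ab /(mul_cancel HG).
elim=> [a av|a b c av ab _ IH]; first by apply: joined_refl; apply: inj.
by apply: (joined_step (y := g ** b)) => //; [apply: inj|rewrite dL].
Qed.

Lemma coblock_refl x : coblock x x.
Proof. by move=> v vx _; apply: joined_refl => e; apply: vx. Qed.

Lemma coblock_sym x y : coblock x y -> coblock y x.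
Proof. by move=> xy v vy vx; apply/(joined_sym Hd)/xy. Qed.

Lemma coblock_mul (g x y : G) : coblock x y -> coblock (g ** x) (g ** y).
Proof.
move=> xy v vx vy; rewrite -[v](mulVKx HG g); apply: joined_mul; apply: xy.
  by move=> e; apply: vx; rewrite -e !gE.
by move=> e; apply: vy; rewrite -e !gE.
Qed.

Arguments coblock_mul g [x y] _ _ _ _.

(* A vertex separating [x] from [y] differs from [a] or from [b]. *)
Lemma coblock_two a b x y : a <> b -> coblock x a -> coblock a y ->
  coblock x b -> coblock b y -> coblock x y.
Proof.
move=> ab xa ay xb by_ v vx vy; have [e|va] := EM (v = a).
  have vb : v <> b by rewrite e.
  by apply: joined_trans (xb v vx vb) (by_ v vb vy).
by apply: joined_trans (xa v vx va) (ay v va vy).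
Qed.

(** Both pairs also share the vertex [one], distinct from [b]. Hence [coblock] is an equivalence on
    block elements, whose classes are the blocks at [one]. *)
Lemma coblock_trans a b c : blockelt a -> blockelt b -> blockelt c ->
  coblock a b -> coblock b c -> coblock a c.
Proof.
move=> [_ a1] [b1 _] [_ c1] ab bc.
by apply: coblock_two ab bc (coblock_sym a1) c1.
Qed.

Lemma blockelt_inv g : blockelt g -> blockelt (inv g).
Proof.
move=> [g1 Ng]; split; first exact: (inv_neq1 HG).
by have := coblock_mul (inv g) (coblock_sym Ng); rewrite !gE.
Qed.

Lemma adjacent_blockelt g : d one g = 1 -> blockelt g.
Proof.
move=> g1; split; first by move=> e; subst g; case: Hd => -[/(_ one one)[_ /(_ erefl)]]; rewrite g1.
move=> v v1 vg; apply: (joined_step (y := g)) => //; first by move=> e; apply: v1.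
by apply: joined_refl => e; apply: vg.
Qed.

Lemma blockelt_near g : blockelt g -> d one g <= 2.
Proof.
move=> [_ Ng]; rewrite leqNgt; apply/negP=> /(separated_far Hd)[v [v1 vg]].
by case; apply: Ng.
Qed.

(** On the geodesic from [y] to [one], either [t] occurs, and the part up to it avoids [one], or the
    whole geodesic avoids [t]. *)
Lemma separating_joined t y : t <> one -> y <> one -> y <> t ->
  ~ joined t one y -> joined one y t.
Proof.
move=> t1 y1 yt nJ.
suff K : forall n z, d z one = n -> z <> one -> joined one z t \/ joined t z one.
  have [//|J] := K _ y erefl y1.
  by case: nJ; apply: (joined_sym Hd).
elim=> [|n IH] z.
  by case: Hd => -[/(_ z one)[H _] _ _ _ _ _] /H.
move=> E z1; have [e|zt] := EM (z = t).
  by left; subst z; apply: joined_refl.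
have dC u v : d u v = d v u by case: Hd => -[].
rewrite dC in E; have [u [u1 uz]] : exists u, d one u = n /\ d u z = 1.
  by case: Hd => _ _ + _ _; apply.
rewrite dC in uz; have [e|nu1] := EM (u = one).
  right; apply: (joined_step zt uz); subst u; apply: joined_refl.
  by move=> e; apply: t1.
have [J|J] := IH u (etrans (dC _ _) u1) nu1.
  by left; apply: joined_step J.
by right; apply: joined_step J.
Qed.

(** Translated by [s]: [s ** t] shares no block with [one], so it is neither [one] nor a block
    element. *)
Definition unmergeable s t := ~ coblock (inv s) t.
Local Notation prod := (foldr mul one).

(** The second clause carries the induction. Applied to the tail and translated by the first letter
    [t], it says that [t] separates [one] from the product; so, once [one] is removed, the product
    lies on the side of [t], which is not the side of [inv s]. *)
Lemma normal_product_neq1 w : chain blockelt unmergeable w -> w <> [::] ->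
  prod w <> one /\ forall s, blockelt s -> unmergeable s (head one w) ->
    ~ joined one (inv s) (prod w).
Proof.
elim: w => // t w IH cw _; have [t1 Nt] : blockelt t by case: cw.
(* If [inv s] and [t] were joined off [one], no vertex would separate them: any other vertex leaves
   both joined to [one]. *)
have last_step y s : unmergeable s t -> blockelt s -> joined one y t ->
    ~ joined one (inv s) y.
  move=> st bs Jy Js; apply: st => v vs vt; have Jst := joined_trans Js Jy.
  have [->//|v1] := EM (v = one).
  have [_ /coblock_sym Ns] := blockelt_inv bs.
  exact: joined_trans (Ns v vs v1) (Nt v v1 vt).
case: w IH cw => [_ _|t2 w IH [bt tt cw]].
  rewrite /= (mulx1 HG); split=> // s bs st.
  by apply: last_step => //; apply: joined_refl.
have [|r1 nJ] := IH cw; first by [].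
have {}nJ := nJ t bt tt.
set r := prod (t2 :: w) in r1 nJ *.
change (t ** r <> one /\ forall s, blockelt s -> unmergeable s t ->
  ~ joined one (inv s) (t ** r)).
have sep : ~ joined t one (t ** r).
  move=> /(joined_mul (inv t)); rewrite !gE; exact: nJ.
have ne : t ** r <> one.
  by move=> e; apply: sep; rewrite e; apply: joined_refl => e1; apply: t1.
split=> // s bs st; apply: last_step => //.
apply: separating_joined => // e; apply: r1.
by apply: (@mul_cancel _ _ _ _ HG t); rewrite e (mulx1 HG).
Qed.

(* [arrow g c c']: in the groupoid whose objects are the blocks at [one], named
   by their elements, [g] leads from the block of [c] to that of [c']. *)
Definition arrow g c c' := (g = one /\ coblock c c') \/
  [/\ blockelt g, coblock g c & coblock (inv g) c'].

Lemma arrow1 c c' : arrow one c c' -> coblock c c'.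
Proof. by case=> [[]|[[]]]. Qed.

Lemma arrow_neq1 g c c' : arrow g c c' -> g <> one ->
  [/\ blockelt g, coblock g c & coblock (inv g) c'].
Proof. by case=> [[]|]. Qed.

Lemma arrow_inv g c c' : arrow g c c' -> arrow (inv g) c' c.
Proof.
case=> [[-> /coblock_sym cc]|[bg gc gc']]; first by left; rewrite !gE.
by right; rewrite gE; split=> //; apply: blockelt_inv.
Qed.

Lemma arrow_coblock g c c' e e' : blockelt c -> blockelt c' -> blockelt e -> blockelt e' ->
  arrow g c c' -> coblock c e -> coblock c' e' -> arrow g e e'.
Proof.
move=> bc bc' be be' [[-> cc]|[bg gc gc']] ce ce'; [left|right].
  split=> //; apply: (coblock_trans be bc be' (coblock_sym ce)).
  exact: coblock_trans cc ce'.
split=> //; first exact: coblock_trans gc ce.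
by apply: coblock_trans gc' ce' => //; apply: blockelt_inv.
Qed.

(** Composability puts [inv g] and [g'] in a common block; translating by [g], so are [one] and
    [g ** g']. The source is kept because [g] and [g ** g'] share a block, being translates of [one]
    and [g']; the target is kept symmetrically. *)
Lemma arrow_mul g g' c c' c'' : blockelt c -> blockelt c' -> blockelt c'' ->
  arrow g c c' -> arrow g' c' c'' -> arrow (g ** g') c c''.
Proof.
move=> bc bc' bc'' A A'; have [e|g1] := EM (g = one).
  subst g; rewrite (mul1x HG); apply: (arrow_coblock bc' bc'') A' _ _ => //.
    exact/coblock_sym/arrow1.
  exact: coblock_refl.
have [e|g1'] := EM (g' = one).
  subst g'; rewrite (mulx1 HG); apply: (arrow_coblock bc bc') A _ _ => //.
    exact: coblock_refl.
  exact: arrow1.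
have [bg gc gc'] := arrow_neq1 A g1; have [bg' gc2 gc2'] := arrow_neq1 A' g1'.
have [bi bi'] := (blockelt_inv bg, blockelt_inv bg').
have [e|gg] := EM (g ** g' = one).
  left; split=> //; have e' := inv_eq HG e; subst g'; rewrite gE in gc2'.
  by apply: coblock_trans (coblock_sym gc) gc2'.
have N : coblock (inv g) g' by apply: coblock_trans gc' (coblock_sym gc2).
have bgg : blockelt (g ** g').
  by split=> //; have := coblock_mul g N; rewrite !gE.
right; split=> //.
  apply: coblock_trans gc => //; apply: coblock_sym.
  by case: bg' => _ /(coblock_mul g); rewrite !gE.
have bigg := blockelt_inv bgg.
apply: coblock_trans gc2' => //; rewrite (inv_mul HG); apply: coblock_sym.
by case: bi => _ /(coblock_mul (inv g')); rewrite !gE.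
Qed.
End Blocks.

(** * From blocks to a free product decomposition *)

Section Decomposition.
Variables (G : Type) (mul : G -> G -> G) (one : G) (inv : G -> G).
Hypothesis HG : is_group mul one inv.
Local Notation "x ** y" := (mul x y) (at level 40, left associativity).
Local Notation gpow := (gpow mul one).
Let gE := (groupE HG).

Variable d : G -> G -> nat.
Hypothesis Hd : geodetic_local3 d.
Hypothesis dL : forall g x y, d (g ** x) (g ** y) = d x y.
Local Notation coblock := (coblock d).
Local Notation blockelt := (blockelt one d).
Local Notation arrow := (arrow one inv d).
Local Notation unmergeable := (unmergeable inv d).

Variables (B : finType) (elt : B -> G).
Hypothesis elt_block : forall c, blockelt (elt c).
Hypothesis elt_onto : forall g, blockelt g -> exists c, elt c = g.

(** Names in [B] stand for the blocks at [one], up to [same]; the classes of [conn] are the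
    components of the groupoid. A name is chosen for each block by [rep] and for each component by
    [base]. *)
Let same c c' : Prop := coblock (elt c) (elt c').
Let conn c c' : Prop := exists g, arrow g (elt c) (elt c').
Let rep c : B := choose (fun c' => `[< same c c' >]) c.
Let base c : B := choose (fun c' => `[< conn c c' >]) c.

Let same_refl c : same c c. Proof. exact: coblock_refl. Qed.
Let same_sym c c' : same c c' -> same c' c.
Proof. exact: coblock_sym. Qed.
Let same_trans a b c : same a b -> same b c -> same a c.
Proof. exact: (coblock_trans Hd). Qed.

Let arr_mul g g' a b c :
  arrow g (elt a) (elt b) -> arrow g' (elt b) (elt c) -> arrow (g ** g') (elt a) (elt c).
Proof. exact: (arrow_mul HG Hd dL). Qed.
Let arr_inv g a b : arrow g (elt a) (elt b) -> arrow (inv g) (elt b) (elt a).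
Proof. exact: (arrow_inv HG Hd dL). Qed.
Let arr_same g a b a' b' : arrow g (elt a) (elt b) -> same a a' -> same b b' ->
  arrow g (elt a') (elt b').
Proof. exact: (arrow_coblock HG Hd dL). Qed.
Let same_arr a b : same a b -> arrow one (elt a) (elt b).
Proof. by left. Qed.

Let choose_class (R : B -> B -> Prop) c :
  (forall c, R c c) -> R c (choose (fun c' => `[< R c c' >]) c).
Proof.
by move=> Rr; apply/asboolP; apply: (chooseP (P := fun c' => `[< R c c' >])); apply/asboolP.
Qed.

Let choose_class_eq (R : B -> B -> Prop) c c' :
  (forall c, R c c) -> (forall a b, R a b -> R b a) ->
  (forall a b c, R a b -> R b c -> R a c) -> R c c' ->
  choose (fun b => `[< R c b >]) c = choose (fun b => `[< R c' b >]) c'.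
Proof.
move=> Rr Rs Rt cc; rewrite (@eq_choose _ _ (fun b => `[< R c' b >])).
  by apply: choose_id; apply/asboolP => //; apply: Rs.
by move=> b; apply/asboolP/asboolP; apply: Rt => //; apply: Rs.
Qed.

Let conn_refl c : conn c c. Proof. by exists one; apply: same_arr. Qed.
Let conn_sym c c' : conn c c' -> conn c' c.
Proof. by move=> [g A]; exists (inv g); apply: arr_inv. Qed.
Let conn_trans a b c : conn a b -> conn b c -> conn a c.
Proof. by move=> [g A] [g' A']; exists (g ** g'); apply: arr_mul A A'. Qed.
Let same_conn a b : same a b -> conn a b.
Proof. by exists one; apply: same_arr. Qed.

Let rep_same c : same c (rep c). Proof. exact: choose_class. Qed.
Let rep_eq c c' : same c c' -> rep c = rep c'.
Proof. exact: choose_class_eq. Qed.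
Let base_conn c : conn c (base c). Proof. exact: choose_class. Qed.
Let base_eq c c' : conn c c' -> base c = base c'.
Proof. exact: choose_class_eq. Qed.
Let base_idem c : base (base c) = base c.
Proof. by apply/esym/base_eq/base_conn. Qed.

(** * A free basis adapted to the groupoid of blocks *)

Section Generators.
Variable x : B -> G.
Hypothesis x_arrow : forall c, arrow (x c) (elt (base c)) (elt c).

(* The classes that receive a free generator: away from the base point of
   their component of the groupoid. *)
Let offbase c := rep c = c /\ ~ same c (base c).

(** Vertex groups are indexed by [(true, c)], cyclic groups by [(false, c)]. The alternative
    [h = one] makes the factor trivial at every index that is not a base point or not [offbase]. *)
Let factor (j : bool * B) (h : G) : Prop :=
  h = one \/
  if j.1 then j.2 = base j.2 /\ arrow h (elt j.2) (elt j.2)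
  else offbase j.2 /\ exists k, h = gpow (x j.2) k \/ h = inv (gpow (x j.2) k).

Inductive letter : (bool * B) * G -> B -> B -> Prop :=
  | letter_vertex c h : c = base c -> arrow h (elt c) (elt c) -> h <> one ->
      letter ((true, c), h) c c
  | letter_pos c : offbase c -> letter ((false, c), x c) (base c) c
  | letter_neg c : offbase c -> letter ((false, c), inv (x c)) c (base c).

Let valid l := exists s t, letter l s t.
(** Powers of a generator are spelled letter by letter, so a generator may follow itself, but not
    its inverse. *)
Let ok (l l' : (bool * B) * G) := l.1 <> l'.1 \/ (l.1.1 = false /\ l.2 = l'.2).

Let offbase_base c c' : offbase c -> base c' = c' -> ~ same c c'.
Proof.
move=> [_ nb] bc' cc'; apply: nb.
by rewrite (base_eq (same_conn cc')) bc'.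
Qed.

Let offbase_same c c' : offbase c -> offbase c' -> same c c' -> c = c'.
Proof. by move=> [rc _] [rc' _] /rep_eq; rewrite rc rc'. Qed.

Let x_neq1 c : offbase c -> x c <> one.
Proof.
move=> [_ nb] e; apply: nb; apply: same_sym; have := x_arrow c; rewrite e.
exact: arrow1.
Qed.

Let letter_arrow l s t : letter l s t -> arrow l.2 (elt s) (elt t) /\ l.2 <> one.
Proof.
case=> [c h cb A h1|c oc|c oc] //=.
  by split; [exact: x_arrow|exact: x_neq1].
by split; [exact: arr_inv|exact/(inv_neq1 HG)/x_neq1].
Qed.

Let arr_neq1 g a b : arrow g (elt a) (elt b) -> ~ same a b -> g <> one.
Proof. by move=> A nab e; apply: nab; subst g; apply: arrow1 A. Qed.

Let arr_unique g a b a' b' : g <> one -> arrow g (elt a) (elt b) ->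
  arrow g (elt a') (elt b') -> same a a' /\ same b b'.
Proof.
move=> g1 A A'; have [bg ga gb] := arrow_neq1 A g1; have [_ ga' gb'] := arrow_neq1 A' g1.
have big := blockelt_inv HG Hd dL bg.
by split; [apply: coblock_trans ga'|apply: coblock_trans gb'] => //;
  apply: coblock_sym.
Qed.

(** Since [inv g] lies in the block of [b] and [g'] in that of [c], mergeable means composable. *)
Let unmergeableP g g' a b c e : g <> one -> g' <> one ->
  arrow g (elt a) (elt b) -> arrow g' (elt c) (elt e) ->
  unmergeable g g' <-> ~ same b c.
Proof.
move=> g1 g1' A A'; have [bg ga gb] := arrow_neq1 A g1; have [bg' gc ge] := arrow_neq1 A' g1'.
have big := blockelt_inv HG Hd dL bg.
split=> H K; apply: H.
  have cg' := coblock_trans Hd (elt_block b) (elt_block c) bg' K (coblock_sym Hd gc).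
  exact: (coblock_trans Hd big (elt_block b) bg' gb cg').
have gc' := coblock_trans Hd big bg' (elt_block c) K gc.
exact: (coblock_trans Hd (elt_block b) big (elt_block c) (coblock_sym Hd gb) gc').
Qed.

(* The first letter [p] of the block normal form of a word starting with [l]. *)
Inductive leading : (bool * B) * G -> G -> B -> Prop :=
  | leading_letter l s t : letter l s t -> leading l l.2 s
  | leading_vertex c h c' : letter ((true, c), h) c c -> offbase c' -> base c' = c ->
      leading ((true, c), h) (h ** x c') c
  | leading_neg c p t : offbase c -> arrow p (elt c) (elt t) -> p <> one ->
      leading ((false, c), inv (x c)) p c.

Let leading_arrow l p s : leading l p s ->
  p <> one /\ exists t, arrow p (elt s) (elt t).
Proof.
case=> [{}l {}s t /letter_arrow[A l1]|c h c' L oc' bc'|c {}p t oc A p1].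
- by split=> //; exists t.
- have [A h1] := letter_arrow L.
  have A' : arrow (h ** x c') (elt c) (elt c').
    by apply: arr_mul A _; rewrite -bc'; apply: x_arrow.
  split; last by exists c'.
  apply: (arr_neq1 A'); move=> /same_sym; apply: offbase_base => //.
  by rewrite -bc' base_idem.
- by split=> //; exists t.
Qed.

(** A nontrivial arrow determines the blocks at its ends, and [x c] and its inverse end in different
    blocks. Hence [ok] excludes cancelling pairs. *)
Let x_noninvolutive c : offbase c -> x c <> inv (x c).
Proof.
move=> oc e; have A := arr_inv (x_arrow c); rewrite -e in A.
have [_ K] := arr_unique (x_neq1 oc) (x_arrow c) A.
by case: (oc).
Qed.

(** A vertex element composes only with a generator leaving its base point. A generator [x c] ends
    off the base, where only [inv (x c)] could follow, against [ok]. An inverse generator absorbs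
    whatever starts at its base point; the result joins distinct blocks or is a conjugate of a
    nontrivial vertex element, so it is not [one]. *)
Let leading_merge l1 s1 t1 l p s : letter l1 s1 t1 -> leading l p s ->
  ok l1 l -> same t1 s -> leading l1 (l1.2 ** p) s1.
Proof.
have vertex_eq c c' : c = base c -> c' = base c' -> same c c' -> c = c'.
  by move=> -> -> /same_conn/base_eq; rewrite !base_idem.
case=> [c h cb A h1|c oc|c oc].
- have eqc c' h' : c' = base c' -> ok ((true, c), h) ((true, c'), h') -> ~ same c c'.
    by move=> c'b o /(vertex_eq _ _ cb c'b) e; subst c'; case: o => -[].
  have neg c' : offbase c' -> ~ same c c'.
    by move=> oc' /same_sym; apply: offbase_base.
  case=> [_ _ _ [c' h' c'b A' h1'|c' oc'|c' oc']|c' h' c2 L oc2 bc2|c' {}p t oc' A' p1] o ts.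
  + by case: (eqc c' h').
  + apply: leading_vertex => //; first exact: letter_vertex.
    by apply: vertex_eq (same_sym ts); rewrite ?base_idem.
  + by case: (neg c').
  + by case: (eqc c' h') => //; rewrite -bc2 base_idem.
  + by case: (neg c').
- have neg c' h' : offbase c' -> h' = inv (x c') -> same c c' ->
      ok ((false, c), x c) ((false, c'), h') -> False.
    move=> oc' -> /(offbase_same oc oc') e; subst c'.
    by case=> [[]//|[_ /= /(x_noninvolutive oc)]].
  case=> [_ _ _ [c' h' c'b A' h1'|c' oc'|c' oc']|c' h' c2 L oc2 bc2|c' {}p t oc' A' p1] o ts.
  + by case: (offbase_base oc (esym c'b) ts).
  + by case: (offbase_base oc (base_idem c') ts).
  + by case: (neg c' (inv (x c'))).
  + by case: (offbase_base oc _ ts); rewrite -bc2 base_idem.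
  + by case: (neg c' (inv (x c'))).
have Ax := arr_inv (x_arrow c).
have neg c' : offbase c' -> ~ same (base c) c'.
  by move=> oc' /same_sym; apply: offbase_base.
case=> [_ _ _ [c' h' c'b A' h1'|c' oc'|c' oc']|c' h' c2 L oc2 bc2|c' {}p t oc' A' p1] o ts.
- have e : base c = c' by apply: vertex_eq; rewrite ?base_idem.
  have Ap : arrow (inv (x c) ** h') (elt c) (elt c') by subst c'; apply: arr_mul Ax A'.
  by apply: (leading_neg oc Ap); apply: (arr_neq1 Ap); apply: offbase_base.
- have e : base c = base c' by apply: vertex_eq; rewrite ?base_idem.
  have Ap : arrow (inv (x c) ** x c') (elt c) (elt c').
    by apply: arr_mul Ax _; rewrite e; apply: x_arrow.
  apply: (leading_neg oc Ap); apply: (arr_neq1 Ap) => /(offbase_same oc oc') e'.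
  subst c'; case: o => [[]//|[_ /= /esym]]; exact: x_noninvolutive.
- by case: (neg c').
- have e : base c = c' by apply: vertex_eq; rewrite -?bc2 ?base_idem // bc2.
  have [Ah h1'] := letter_arrow L.
  have Ap : arrow (inv (x c) ** (h' ** x c2)) (elt c) (elt c2).
    apply: arr_mul Ax _; apply: (arr_mul (b := c')); first by rewrite e.
    by rewrite -bc2; apply: x_arrow.
  apply: (leading_neg oc Ap) => E; rewrite E in Ap.
  have e' := offbase_same oc oc2 (arrow1 Ap); subst c2.
  have F := inv_eq HG E; rewrite (invxK HG) in F.
  by apply: h1'; rewrite /= -(mulx1 HG h') -(mulxV HG (x c)) -(mulgA HG) -F (mulxV HG).
by case: (neg c').
Qed.

(** Reading from the right, each letter either opens a new block element or is absorbed by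
    [leading_merge]. Absorption keeps the target of [p], hence its unmergeability with the next
    block element. *)
Let word_normal l w s t : letter l s t -> chain valid ok (l :: w) ->
  exists p ps, [/\ leading l p s, chain blockelt unmergeable (p :: ps) &
    foldr mul one (p :: ps) = foldr (fun a g => a.2 ** g) one (l :: w)].
Proof.
elim: w l s t => [|l' w IH] l s t L.
  have [A l1] := letter_arrow L; have [bl _ _] := arrow_neq1 A l1.
  by move=> _; exists l.2, [::]; split=> //; apply: leading_letter L.
have [A l1] := letter_arrow L; have [bl _ _] := arrow_neq1 A l1.
move=> [_ ll' cw]; have [[s' [t' L']] _ _] := cw.
have [p [ps [lp cps E]]] := IH _ _ _ L' cw.
have [p1 [e Ap]] := leading_arrow lp.
have [ts|nts] := EM (same t s'); last first.
  exists l.2, (p :: ps); split; first exact: leading_letter L.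
    split=> //; exact/(unmergeableP l1 p1 A Ap).
  by rewrite -[LHS]/(l.2 ** foldr mul one (p :: ps)) E.
have lm : leading l (l.2 ** p) s.
  by apply: leading_merge ll' ts.
exists (l.2 ** p), ps; split=> //; last first.
  by rewrite /= (mulgA HG) -[p ** _]/(foldr mul one (p :: ps)) E.
have [lp1 [e' Alp]] := leading_arrow lm.
have Alp' : arrow (l.2 ** p) (elt s) (elt e) by apply: arr_mul A _; apply: arr_same Ap (same_sym ts) (@same_refl e).
have [blp _ _] := arrow_neq1 Alp lp1.
case: cps => bp pps cps; split=> //.
case: ps pps cps {E} => // q ps pq [bq _ _] K; apply: pq.
have [_ _ pe] := arrow_neq1 Ap p1; have [_ _ lpe] := arrow_neq1 Alp' lp1.
have inv_block := blockelt_inv HG Hd dL.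
have bp' := inv_block _ bp; have blp' := inv_block _ blp.
have pK := coblock_trans Hd bp' (elt_block e) blp' pe (coblock_sym Hd lpe).
exact: (coblock_trans Hd bp' blp' bq pK K).
Qed.

Let word_neq1 w : chain valid ok w -> w <> [::] ->
  foldr (fun a g => a.2 ** g) one w <> one.
Proof.
case: w => // l w cw _; case: (cw) => -[s [t L]] _ _.
have [p [ps [_ cps <-]]] := word_normal L cw.
by have [] := normal_product_neq1 HG Hd dL cps.
Qed.

Let x_infinite c k : offbase c -> gpow (x c) k.+1 <> one.
Proof.
move=> oc; have L := letter_pos oc; have ok' : ok ((false, c), x c) ((false, c), x c) by right.
have vL : valid ((false, c), x c) by exists (base c), c.
have [cw E] := chain_nseq HG snd k vL ok' (I : chain valid ok [::]) I.
by rewrite -(mulx1 HG (gpow (x c) k.+1)) -[gpow _ _ ** _]E; apply: word_neq1.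
Qed.

Let Factor (i : nat) (h : G) := exists j : bool * B, (enum_rank j : nat) = i /\ factor j h.
Let size_family := #|{: bool * B}|.

Let factor_subgroup j : is_subgroup mul one inv (factor j).
Proof.
have V (K : G -> Prop) P : is_subgroup mul one inv K ->
    is_subgroup mul one inv (fun h => h = one \/ P /\ K h).
  move=> [K1 KM KV]; split; first by left.
    move=> a b [->|[p ka]] [->|[p2 kb]]; rewrite ?gE; [by left|by right|by right|].
    by right; split=> //; apply: KM.
  by move=> a [->|[p ka]]; [left; rewrite gE|right; split=> //; apply: KV].
case: j => -[] c; apply: V; last exact: cyclic_is_subgroup.
split; [exact/same_arr/same_refl|by move=> a b; apply: arr_mul|by move=> a; apply: arr_inv].
Qed.

Let Factor_rank j h : Factor (enum_rank j) h <-> factor j h.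
Proof.
split=> [[j' [e Hj]]|]; last by exists j.
by have <- : j' = j by apply/enum_rank_inj/val_inj.
Qed.

Let Factor_ord i : i < size_family -> exists j : bool * B, i = enum_rank j.
Proof. 
move=> li; have [k ->] : exists k : 'I_#|{: bool * B}|, i = k by exists (Ordinal li).
by exists (enum_val k); rewrite enum_valK.
 Qed.

Let Factor_subgroup i : i < size_family -> is_subgroup mul one inv (Factor i).
Proof.
move=> /Factor_ord[j ->]; have [f1 fM fV] := factor_subgroup j.
split; [exact/Factor_rank|move=> a b|move=> a].
  by move=> /Factor_rank fa /Factor_rank fb; apply/Factor_rank/fM.
by move=> /Factor_rank fa; apply/Factor_rank/fV.
Qed.

Let Factor_kind i : i < size_family ->
  finite_subgroup mul one inv (Factor i) \/ infinite_cyclic_subgroup mul one inv (Factor i).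
Proof.
move=> li; have sF := Factor_subgroup li; have [j e] := Factor_ord li; subst i.
have fin (s : seq {classic G}) : (forall h, factor j h -> h \in s) ->
    finite_subgroup mul one inv (Factor (enum_rank j)).
  move=> H; split=> //; exists [seq h <- s | `[< factor j h >]] => h; split.
    move/Factor_rank=> fh; apply/(@In_mem {classic G}); rewrite mem_filter H // andbT; exact/asboolP.
  by move/(@In_mem {classic G}); rewrite mem_filter => /andP[/asboolP fh _]; apply/Factor_rank.
case: j {li sF} fin => -[] c fin; last first.
  have [oc|noc] := EM (offbase c); last first.
    by left; apply: (fin [:: one]) => h [->|[/noc]] //; apply/(@In_mem {classic G}); left.
  right; exists (x c); split; last by move=> k; apply: x_infinite.
  move=> h; split=> [/Factor_rank[->|[_]] //|[k hk]]; first by exists 0; left.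
  by apply/Factor_rank; right; split=> //; exists k.
left; apply: (fin (one :: [seq (elt b : {classic G}) | b <- enum B])) => h.
move=> fh; apply/(@In_mem {classic G}); have [->|h1] := EM (h = one); first by left.
case: fh => [//|[_ A]]; have [bh _ _] := arrow_neq1 A h1; have [b <-] := elt_onto bh.
by right; apply/(@In_mem {classic G})/mapP; exists b; rewrite ?mem_enum.
Qed.

(** A cyclic syllable becomes a power of one letter; the last clause remembers the factor of the
    first letter, so that syllables of distinct factors stay [ok]. *)
Let expand w : reduced one size_family Factor w -> exists u,
  [/\ chain valid ok u, foldr (fun a g => a.2 ** g) one u = wprod mul one w &
     match w with
     | [::] => u = [::]
     | a :: _ => exists l u', u = l :: u' /\ (enum_rank l.1 : nat) = a.1
     end].
Proof.
elim: w => [|[i h] w IH] /=; first by exists [::].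
move=> [li [j [ij fh]] h1 iw /IH[u [cu Eu hu]]].
have jok l : l.1 = j -> match u with [::] => True | b :: _ => ok l b end.
  move=> lj; case: u hu {cu Eu} => // b u hu; left => lb.
  case: w iw hu {IH} => [//|[i' h'] w] iw [l' [u' [[? ?] e]]]; subst b u'.
  by apply: iw; rewrite -ij -lj lb.
have power l k : l.1 = j -> valid l -> l.1.1 = false -> gpow l.2 k = h ->
    exists v, [/\ chain valid ok v, foldr (fun a g => a.2 ** g) one v = h ** wprod mul one w &
     exists l u', v = l :: u' /\ (enum_rank l.1 : nat) = i].
  move=> lj vl l0 E; case: k E => [/esym //|k E].
  have [|cv Ev] := chain_nseq HG snd k vl _ cu (jok l lj); first by right.
  exists (nseq k.+1 l ++ u); split=> //; first by rewrite [LHS]Ev Eu E.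
  by exists l, (nseq k l ++ u); rewrite lj.
case: fh => [//|]; case: j ij jok power => -[] c ij jok power /=.
  move=> [cb A]; exists (((true, c), h) :: u); split.
  - by split=> //; [exists c, c; apply: letter_vertex|apply: jok].
  - by rewrite /= Eu.
  - by exists ((true, c), h), u.
move=> [oc [k [e|e]]].
  by apply: (power ((false, c), x c) k) => //; exists (base c), c; apply: letter_pos.
apply: (power ((false, c), inv (x c)) k) => //; first by exists c, (base c); apply: letter_neg.
by rewrite gpowV.
Qed.

(** The arrow is [one] in the block of the base point and the generator of [rep c] elsewhere. *)
Let to_base c : exists g, arrow g (elt (base c)) (elt c) /\ exists j, factor j g.
Proof.
have [s|ns] := EM (same c (base c)).
  by exists one; split; [exact/same_arr/same_sym|exists (true, c); left].
have e : rep (rep c) = rep c by apply/esym/rep_eq/rep_same.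
have eb : base c = base (rep c) by apply/base_eq/same_conn/rep_same.
exists (x (rep c)); split.
  rewrite eb; apply: (arr_same (x_arrow (rep c)) (@same_refl _)).
  exact/same_sym/rep_same.
exists (false, rep c); right; split; last by exists 1; left; rewrite /= (mulx1 HG).
split=> // K; apply: ns; rewrite eb; apply: same_trans K; exact: rep_same.
Qed.

Lemma plain_of_arrows : (forall Q : G -> Prop, Q one ->
     (forall h g, blockelt h -> Q g -> Q (h ** g)) -> forall g, Q g) ->
  plain mul one inv.
Proof.
move=> gen; exists size_family, Factor; split; first exact: Factor_kind.
apply: (free_product_of_reduced HG Factor_subgroup).
  move=> Q Q1 QM; apply: gen => // h g bh Qg.
  have Qf j k r : factor j k -> Q r -> Q (k ** r).
    move=> /Factor_rank fk; exact: QM (ltn_ord _) fk.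
  have [c cE] := elt_onto bh; have [c' cE'] := elt_onto (blockelt_inv HG Hd dL bh).
  have A : arrow h (elt c) (elt c').
    by right; split=> //; rewrite ?cE ?cE'; apply: coblock_refl.
  have [a [Aa [ja fa]]] := to_base c; have [b [Ab [jb fb]]] := to_base c'.
  have [_ _ fV] := factor_subgroup ja.
  have Am : arrow (a ** (h ** inv b)) (elt (base c)) (elt (base c)).
    apply: arr_mul Aa _; apply: (arr_mul A).
    rewrite (base_eq (ex_intro _ h A : conn c c')).
    exact: arr_inv.
  (* The arrow [h] is closed up to a loop at the base point common to its two ends. *)
  have -> : h ** g = inv a ** (a ** (h ** inv b) ** (b ** g)) by rewrite !gE.
  apply: (Qf ja _ _ (fV _ fa)); apply: (Qf (true, base c)); last exact: (Qf jb).
  by right; split; rewrite ?base_idem.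
move=> w /expand[u [cu <- hu]] nw; apply: word_neq1 cu _.
by case: w hu nw => // a w [l [u' [-> _]]].
Qed.
End Generators.

Lemma plain_of_blocks : (forall Q : G -> Prop, Q one ->
     (forall h g, blockelt h -> Q g -> Q (h ** g)) -> forall g, Q g) ->
  plain mul one inv.
Proof.
by have [x xA] := choice (fun c => conn_sym (base_conn c)); apply: plain_of_arrows xA.
Qed.
End Decomposition.

(** * Groups presented by length-reducing systems *)

Definition words2 (Sigma : finType) : seq (seq Sigma) :=
  [::] :: [seq [:: a] | a <- enum Sigma] ++
  [seq [:: a; b] | a <- enum Sigma, b <- enum Sigma].

Lemma mem_words2 (Sigma : finType) (w : seq Sigma) : (w \in words2 Sigma) = (size w <= 2).
Proof.
apply/idP/idP; rewrite inE mem_cat.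
  by move=> /orP[/eqP->|/orP[/mapP[a _ ->]|/allpairsP[[a b] [_ _ ->]]]].
case: w => [|a [|b []]] // _; apply/orP; right; apply/orP.
  by left; apply: map_f; rewrite mem_enum.
by right; apply: allpairs_f; rewrite mem_enum.
Qed.

(** * Irreducible words of a length-reducing system *)

Section Rewriting.
Variables (Sigma : finType) (T : seq (seq Sigma * seq Sigma)).
Hypothesis Tred : length_reducing T.
Local Notation rstep := (rstep T).
Local Notation rstar := (rstar T).
Local Notation rconv := (rconv T).

Definition irreducible w := forall y, ~ rstep w y.

Lemma rstep_size x y : rstep x y -> size y < size x.
Proof. by move=> [u [v [l [r [/Tred lr [-> ->]]]]]]; rewrite !size_cat ltn_add2l ltn_add2r. Qed.

Lemma length_reducing_terminating : terminating T.
Proof.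
move=> [f fS]; have H n : size (f n) + n <= size (f 0).
  by elim: n => [|n IH]; [lia|have := rstep_size (fS n); lia].
by have := H (size (f 0)).+1; lia.
Qed.

Lemma rstar_irreducible w : exists2 z, rstar w z & irreducible z.
Proof.
have [n] := ubnP (size w); elim: n w => // n IH w le.
have [[y wy]|nw] := EM (exists y, rstep w y); last first.
  by exists w; [exact: rstar_refl|move=> y wy; apply: nw; exists y].
have [|z yz iz] := IH y; first by have := rstep_size wy; lia.
by exists z => //; apply: rstar_step yz.
Qed.

Lemma rstar_trans x y z : rstar x y -> rstar y z -> rstar x z.
Proof. by elim=> // a b c ab _ IH /IH; apply: rstar_step. Qed.

Lemma rstar_rconv x y : rstar x y -> rconv x y.
Proof. by elim=> [a|a b c ab _]; [exact: rconv_refl|exact: rconv_fwd]. Qed.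

Lemma rconv_trans x y z : rconv x y -> rconv y z -> rconv x z.
Proof.
by elim=> // a b c ab _ IH /IH; [apply: rconv_fwd|apply: rconv_bwd].
Qed.

Lemma rconv_sym x y : rconv x y -> rconv y x.
Proof.
elim=> [a|a b c ab _ IH|a b c ba _ IH]; first exact: rconv_refl.
  by apply: rconv_trans IH _; apply: (rconv_bwd ab); apply: rconv_refl.
by apply: rconv_trans IH _; apply: (rconv_fwd ba); apply: rconv_refl.
Qed.

Lemma rstar_size x y : rstar x y -> size y <= size x.
Proof. by elim=> // a b c /rstep_size ab _; lia. Qed.

Lemma irreducible_rstar x y : irreducible x -> rstar x y -> x = y.
Proof. by move=> ix xy; case: xy ix => // a b c ab _ /(_ b). Qed.

Lemma church_rosser x y : confluent T -> rconv x y ->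
  exists2 z, rstar x z & rstar y z.
Proof.
move=> conf; elim=> [a|a b c ab _ [z bz cz]|a b c ba _ [z bz cz]].
- by exists a; apply: rstar_refl.
- by exists z => //; apply: rstar_step bz.
have [||t [at_ zt]] := conf b a z => //; first by apply: (rstar_step ba); apply: rstar_refl.
by exists t => //; apply: rstar_trans zt.
Qed.

Lemma irreducible_unique x y : confluent T -> rconv x y ->
  irreducible x -> irreducible y -> x = y.
Proof.
move=> conf /(church_rosser conf)[z xz yz] ix iy.
by rewrite (irreducible_rstar ix xz) (irreducible_rstar iy yz).
Qed.

(** An occurrence of a left-hand side either misses the last letter or, having length at most three,
    lies within the last three. *)
Lemma irreducible_rcons u a b c : lhs_at_most_three T ->
  irreducible (u ++ [:: a; b]) -> irreducible [:: a; b; c] ->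
  irreducible (u ++ [:: a; b; c]).
Proof.
move=> T3 iab iabc y [u' [v [l [r [lr [E _]]]]]].
have l3 := T3 _ _ lr.
case/lastP: v E => [|v e] E.
  rewrite cats0 in E; have sE := congr1 size E; rewrite !size_cat /= in sE.
  have le : size u <= size u' by rewrite -(leq_add2r 3) sE leq_add2l.
  have Eu : u = take (size u) u'.
    by have := congr1 (take (size u)) E; rewrite take_size_cat // takel_cat.
  apply: (iabc (drop (size u) u' ++ r)).
  exists (drop (size u) u'), [::], l, r; split=> //; rewrite !cats0; split=> //.
  move: E; rewrite -{1}(cat_take_drop (size u) u') -Eu -catA => /eqP.
  by rewrite eqseq_cat // eqxx => /eqP.
apply: (iab (u' ++ r ++ v)); exists u', v, l, r; split=> //; split=> //.
have : rcons (u ++ [:: a; b]) c = rcons (u' ++ l ++ v) e.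
  by rewrite -!cats1 -!catA /= E -cats1.
by case/rcons_inj.
Qed.
End Rewriting.

Section PresentedIsPlain.
Variables (G : Type) (mul : G -> G -> G) (one : G) (inv : G -> G).
Hypothesis HG : is_group mul one inv.
Local Notation "x ** y" := (mul x y) (at level 40, left associativity).
Let gE := (groupE HG).
Variables (Sigma : finType) (T : seq (seq Sigma * seq Sigma)) (pi : seq Sigma -> G).
Hypotheses (Tpres : presents mul one T pi).
Hypothesis Sinv : forall a : Sigma, exists b : Sigma, pi [:: a] ** pi [:: b] = one.
Hypotheses (Tred : length_reducing T) (T3 : lhs_at_most_three T) (Tconf : confluent T).

Let pi0 : pi [::] = one. Proof. by case: Tpres. Qed.
Let piD u v : pi (u ++ v) = pi u ** pi v. Proof. by case: Tpres. Qed.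

Variable nf : G -> seq Sigma.
Hypothesis nfP : forall g, pi (nf g) = g /\ irreducible T (nf g).

Let pi_nf g : pi (nf g) = g. Proof. by case: (nfP g). Qed.

Let nf_irreducible w : irreducible T w -> nf (pi w) = w.
Proof.
move=> iw; have [e inf] := nfP (pi w); apply: irreducible_unique inf iw => //.
by case: Tpres => _ _ _ H; apply/H.
Qed.

Let nf_rstar w : rstar T w (nf (pi w)).
Proof.
have [z wz iz] := rstar_irreducible Tred w.
suff -> : pi w = pi z by rewrite nf_irreducible.
by case: Tpres => _ _ _ H; apply/H/rstar_rconv.
Qed.

Let nf_size w : size (nf (pi w)) <= size w.
Proof. exact: rstar_size (nf_rstar w). Qed.

(** Any rewriting step would make the normal form strictly shorter than [w]; thus geodesic words are
    unique. *)
Let nf_shortest w : size w <= size (nf (pi w)) -> nf (pi w) = w.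
Proof.
move=> le; case: (nf_rstar w) le => // a b c /(rstep_size Tred) ab bc le.
by have := rstar_size Tred bc; lia.
Qed.

(** The metric of the Cayley graph: rewriting never lengthens, so normal forms are shortest
    words. *)
Definition word_dist x y := size (nf (inv x ** y)).

Let dist_pi x w : word_dist x (x ** pi w) <= size w.
Proof. by rewrite /word_dist (mulKx HG); apply: nf_size. Qed.

Let dist_mul g x y : word_dist (g ** x) (g ** y) = word_dist x y.
Proof. by rewrite /word_dist !gE. Qed.

Let dist_tri x y z : word_dist x z <= word_dist x y + word_dist y z.
Proof.
have := dist_pi x (nf (inv x ** y) ++ nf (inv y ** z)).
by rewrite piD !pi_nf !gE size_cat.
Qed.

(** Closure of the alphabet under inverses lets a word be inverted letter by letter without changing
    its length. *)
Let dist_le_sym x y : word_dist x y <= word_dist y x.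
Proof.
have H w : exists w', size w' = size w /\ pi w' = inv (pi w).
  elim: w => [|a w [w' [sw E]]]; first by exists [::]; rewrite pi0 gE.
  have [b ab] := Sinv a; exists (w' ++ [:: b]); rewrite size_cat sw addn1; split=> //.
  by rewrite piD E -[a :: w]cat1s piD (inv_mul HG) (inv_eq HG ab).
have [w' [sw E]] := H (nf (inv y ** x)).
rewrite /word_dist -[X in _ <= X]sw.
have -> : inv x ** y = pi w' by rewrite E pi_nf !gE.
exact: nf_size.
Qed.

Let dist_sym x y : word_dist x y = word_dist y x.
Proof. by apply/eqP; rewrite eqn_leq !dist_le_sym. Qed.

Let dist_concat x y z : word_dist x z = word_dist x y + word_dist y z ->
  nf (inv x ** z) = nf (inv x ** y) ++ nf (inv y ** z).
Proof.
move=> E; rewrite -[RHS]nf_shortest piD !pi_nf !gE //.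
by rewrite size_cat; move: E; rewrite /word_dist => ->.
Qed.

Lemma word_dist_geodetic : geodetic_local3 word_dist.
Proof.
split; first split=> // x y.
- split=> [/size0nil E|->].
    have := pi_nf (inv x ** y); rewrite E pi0 => e.
    by rewrite -[y](mulVKx HG x) -e !gE.
  by have := dist_pi y [::]; rewrite pi0 !gE; case: word_dist.
- exact: dist_tri.
- move=> x y n E; have nz : size (nf (inv x ** y)) = n.+1 := E.
  case/lastP: (nf (inv x ** y)) (pi_nf (inv x ** y)) nz => // w a Ew.
  rewrite size_rcons => -[sw]; exists (x ** pi w).
  have y_eq : y = x ** pi w ** pi [:: a].
    by rewrite (mulgA HG) -piD cats1 Ew !gE.
  have := dist_pi x w; have := dist_pi (x ** pi w) [:: a]; rewrite -y_eq /=.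
  by have := dist_tri x (x ** pi w) y; rewrite E sw; lia.
- move=> x y z z' xy zy xy' zy'.
  have E := dist_concat (etrans xy (esym (etrans (congr1 (addn _) zy) (addn1 _)))).
  have E' := dist_concat (etrans xy' (esym (etrans (congr1 (addn _) zy') (addn1 _)))).
  rewrite E in E'; move/eqP: E'; rewrite eqseq_cat; last first.
    by move: xy xy'; rewrite /word_dist => -> [].
  move=> /andP[/eqP e _]; have := congr1 pi e; rewrite !pi_nf.
  exact: (mul_cancel HG).
move=> x u v z z' uv vz zz xz uz.
have uz2 : word_dist u z = 2.
  have := dist_tri x u z; have := dist_tri u v z; lia.
have Ez : nf (inv x ** z) = nf (inv x ** u) ++ nf (inv u ** z) by apply: dist_concat; lia.
have Euz : nf (inv u ** z) = nf (inv u ** v) ++ nf (inv v ** z) by apply: dist_concat; lia.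
have Euz' : nf (inv u ** z') = nf (inv u ** z) ++ nf (inv z ** z') by apply: dist_concat; lia.
have letter_nf a b : word_dist a b = 1 -> exists c, nf (inv a ** b) = [:: c].
  by rewrite /word_dist; case: (nf _) => [|c []] // _; exists c.
have [a Ea] := letter_nf _ _ uv; have [b Eb] := letter_nf _ _ vz.
have [c Ec] := letter_nf _ _ zz; rewrite Euz Ea Eb Ec /= in Ez Euz'.
have [_ iz] := nfP (inv x ** z); have [_ iuz'] := nfP (inv u ** z').
rewrite Ez in iz; rewrite Euz' in iuz'.
(* The normal form up to [z] ends in the letters [a], [b], and [a], [b], [c] is irreducible, so
   appending [c] gives a normal form. *)
have := nf_irreducible (irreducible_rcons T3 iz iuz').
rewrite piD -Euz' !pi_nf !gE /word_dist => ->.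
by rewrite size_cat Euz' addn3.
Qed.

Lemma presented_is_plain : plain mul one inv.
Proof.
(* The ball of radius two, which contains every block element by [blockelt_near]. *)
pose close : seq {classic G} := [seq pi w | w <- words2 Sigma].
pose Bs : seq {classic G} := [seq g <- close | `[< blockelt one word_dist g >]].
have BsP (g : {classic G}) : g \in Bs <-> blockelt one word_dist g.
  rewrite mem_filter; split=> [/andP[/asboolP] //|bg].
  apply/andP; split; first exact/asboolP.
  apply/mapP; exists (nf g); rewrite ?pi_nf // mem_words2.
  by have := blockelt_near word_dist_geodetic bg; rewrite /word_dist !gE.
apply: (plain_of_blocks HG word_dist_geodetic dist_mul (B := seq_sub Bs) (elt := @ssval _ Bs)).
- by move=> c; apply/BsP/ssvalP.
- by move=> g /BsP gB; exists (SeqSub gB).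
move=> Q Q1 QM g; rewrite -(pi_nf g); elim: (nf g) => [|a w IH]; first by rewrite pi0.
rewrite -cat1s piD; have [->|a1] := EM (pi [:: a] = one); first by rewrite gE.
apply: QM IH; apply: (adjacent_blockelt word_dist_geodetic).
have := dist_pi one [:: a]; rewrite gE /=.
case E : (word_dist one _) => [|[|n]] // _; case: a1; apply/esym.
by have [[H _] _ _ _ _] := word_dist_geodetic; apply/H.
Qed.
End PresentedIsPlain.

(** * Presentations of plain groups *)

Definition short_rules (Sigma : finType) (G : Type) (pi : seq Sigma -> G) :=
  [seq rule <- [seq (l, r) | l <- words2 Sigma, r <- words2 Sigma] |
     `[< size rule.2 < size rule.1 /\ pi rule.1 = pi rule.2 >]].

Lemma mem_short_rules (Sigma : finType) (G : Type) (pi : seq Sigma -> G) l r :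
  (l, r) \in short_rules pi <-> [/\ size l <= 2, size r < size l & pi l = pi r].
Proof.
rewrite mem_filter; split.
  case/andP=> /asboolP[rl E] /allpairsP[[l' r'] [+ _ [e _]]].
  by rewrite mem_words2 -e.
move=> [l2 rl E]; apply/andP; split; first exact/asboolP.
by apply: allpairs_f; rewrite mem_words2 //; apply: leq_trans (ltnW rl) l2.
Qed.

Section PlainIsPresented.
Variables (G : Type) (mul : G -> G -> G) (one : G) (inv : G -> G).
Hypothesis HG : is_group mul one inv.
Local Notation "x ** y" := (mul x y) (at level 40, left associativity).
Local Notation gpow := (gpow mul one).
Let gE := (groupE HG).

(** The final disjunction keeps what matters of the kind of [K]. For a finite factor, [L] together
    with [one] is closed under products; for a cyclic one, two letters either cancel or are equal,
    and their product is never a letter. *)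
Definition factor_letters (K : G -> Prop) (L : seq {classic G}) : Prop :=
  [/\ is_subgroup mul one inv K,
      forall h, h \in L -> [/\ K h, h <> one & (inv h : {classic G}) \in L],
      forall h, K h -> exists w : seq {classic G}, {subset w <= L} /\ foldr mul one w = h &
      (forall h k, h \in L -> k \in L -> h ** k = one \/ (h ** k : {classic G}) \in L) \/
      (forall h k, h \in L -> k \in L -> [/\ (h ** k : {classic G}) \notin L,
           h ** k <> one -> h = k & forall m, gpow h m.+1 <> one])].

Lemma finite_letters K : finite_subgroup mul one inv K ->
  exists L, factor_letters K L.
Proof.
move=> [sK [s sP]]; pose s' : seq {classic G} := s.
exists [seq h : {classic G} <- s' | `[< h <> one :> G >]].
have LP (h : {classic G}) : (h \in [seq h : {classic G} <- s' | `[< h <> one :> G >]]) <-> (K h /\ h <> one :> G).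
  rewrite mem_filter sP; split=> [/andP[/asboolP h1 /(@In_mem {classic G})]//|[Kh h1]].
  by apply/andP; split; [exact/asboolP|exact/(@In_mem {classic G})].
have [K1 KM KV] := sK; split=> //.
- move=> h /LP[Kh h1]; split=> //; apply/LP; split; [exact: KV|exact: (inv_neq1 HG)].
- move=> h Kh; have [->|h1] := EM (h = one); first by exists [::].
  exists [:: h]; split; last by rewrite /= gE.
  by move=> k; rewrite inE => /eqP ->; apply/LP.
left=> h k /LP[Kh h1] /LP[Kk k1]; have [|hk] := EM (h ** k = one); first by left.
by right; apply/LP; split=> //; apply: KM.
Qed.

Lemma cyclic_letters K : infinite_cyclic_subgroup mul one inv K ->
  exists L, factor_letters K L.
Proof.
move=> [g [KP ginf]]; exists [:: (g : {classic G}); inv g].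
have LP (h : {classic G}) : (h \in [:: (g : {classic G}); inv g]) <-> (h = g \/ h = inv g).
  split=> [/(@In_mem {classic G}) [<-|[<-|//]]|e]; [by left|by right|].
  by apply/(@In_mem {classic G}); case: e => ->; [left|right; left].
have g1 : g <> one by move=> e; apply: (ginf 0); rewrite /= gE.
have gi : inv g <> one by apply: (inv_neq1 HG).
have K1 : K g by apply/KP; exists 1; left; rewrite /= gE.
have Ki : K (inv g) by apply/KP; exists 1; right; rewrite /= (mulx1 HG).
have power_word (a : {classic G}) k : a = g \/ a = inv g ->
    exists w : seq {classic G}, {subset w <= [:: (g : {classic G}); inv g]} /\
    foldr mul one w = gpow a k.
  move=> /LP aL; exists (nseq k a); split; last by elim: k => //= k ->.
  by move=> b /nseqP[-> _].
split.
- have [S1 SM SV] := cyclic_is_subgroup HG g.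
  by split; [exact/KP|move=> x y /KP ? /KP ?; apply/KP/SM|move=> x /KP ?; apply/KP/SV].
- by move=> h /LP[->|->]; split=> //; apply/LP; [right|left; rewrite gE].
- by move=> h /KP[k [->|->]]; rewrite -?(gpowV HG); apply: power_word; [left|right].
right.
have g2 : g ** g <> g by move=> e; apply: g1; apply: (mul_cancel HG (x := g)); rewrite e gE.
have g3 : g ** g <> inv g by move=> e; apply: (ginf 2); rewrite /= gE e gE.
have pow m h : h = g \/ h = inv g -> gpow h m.+1 <> one.
  move=> [->|->]; first exact: ginf.
  by rewrite (gpowV HG); apply: (inv_neq1 HG); apply: ginf.
have inv2 : inv (g ** g) = inv g ** inv g by rewrite !gE.
have ig2 : inv g ** inv g <> inv g.
  by rewrite -inv2 => e; apply: g2; rewrite -[LHS](invxK HG) e gE.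
have ig3 : inv g ** inv g <> g.
  by rewrite -inv2 => e; apply: g3; rewrite -[LHS](invxK HG) e.
move=> h k /LP eh /LP ek; split; last by move=> m; apply: pow.
  by apply/negP=> /LP; case: eh ek => -> [] ->; rewrite ?gE => -[] //; apply: nesym.
by case: eh ek => -> [] ->; rewrite ?gE.
Qed.

Variables (n : nat) (H : nat -> G -> Prop).
Hypothesis Hfree : free_product_of mul one n H.
Variable L : nat -> seq {classic G}.
Hypothesis HL : forall i, i < n -> factor_letters (H i) (L i).

Local Notation syllable := (nat * {classic G})%type.
Let valid (a : syllable) : Prop := a.1 < n /\ a.2 \in L a.1.
Let mergeable (a b : syllable) : Prop := a.1 = b.1 /\
  (a.2 ** b.2 = one \/ (a.2 ** b.2 : {classic G}) \in L a.1).
Let ok a b := ~ mergeable a b.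
Local Notation prod := (foldr (fun (a : syllable) g => a.2 ** g) one).

(** The leading run of letters from one factor is multiplied out. In a finite factor the run is a
    single letter; in a cyclic one its letters are equal, so its value is a positive power of [h]
    and not [one]. *)
Let collapse i h u : chain valid ok ((i, h) :: u) -> exists k w,
  [/\ reduced one n H ((i, k) :: w), k ** wprod mul one w = h ** prod u &
     (forall h' k', h' \in L i -> k' \in L i -> h' ** k' = one \/ (h' ** k' : {classic G}) \in L i)
     \/ exists m, k = gpow h m.+1].
Proof.
elim: u i h => [|[j k] u IH] i h [[/= li hL] hu cu].
  have [_ LP _ _] := HL li; have [Hh h1 _] := LP _ hL.
  by exists h, [::]; split=> //; right; exists 0; rewrite /= gE.
have [_ LP _ kind] := HL li; have [Hh h1 _] := LP _ hL.
have [k' [w [rw E pw]]] := IH _ _ cu.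
have [e|ij] := EM (i = j); last first.
  exists h, ((j, k') :: w); rewrite /= E; split=> //.
  by right; exists 0; rewrite /= gE.
subst j; case: cu => [[/= _ kL] _ _].
case: kind => [fin|inf]; first by case: hu; split=> //; apply: fin.
have [hkL hk pow] := inf h k hL kL.
case: pw => [fin|[m k'E]].
  by have [e|e] := fin h k hL kL; [case: hu; split=> //; left|case/negP: hkL].
have e : h = k by apply: hk => e; apply: hu; split=> //; left.
subst k; exists (h ** k'), w; rewrite k'E; split; last by right; exists m.+1.
  case: rw => _ Hk' _ iw rw; split=> //; last exact: pow m.+1.
  by have [[_ HM _] _ _ _] := HL li; apply: HM => //; rewrite -k'E.
by rewrite -k'E (mulgA HG) E.
Qed.

Let letters_unique u v : chain valid ok u -> chain valid ok v -> prod u = prod v -> u = v.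
Proof.
have inverse b : valid b -> exists b', [/\ valid b', b'.2 = inv b.2, ~ ok b b' & b'.1 = b.1].
  move=> [li bL]; have [_ LP _ _] := HL li; have [_ _ iL] := LP _ bL.
  exists (b.1, inv b.2); split=> //; apply; split=> //=; left; exact: mulxV HG _.
apply: (chain_unique HG (val := snd)).
- by move=> b /inverse[b' [? ? ? _]]; exists b'.
- move=> b a vb va; have [b' [vb' Eb nok ib]] := inverse b vb.
  have [m|nm] := EM (mergeable b' a); last by constructor 1; exists b'.
  case: m; rewrite ib Eb => ba [e|iL].
    constructor 2; case: a b ba e {va vb vb' nok Eb ib} => [i h] [j k] /= -> e.
    by rewrite -[h](mulVKx HG k) e gE.
  constructor 3; exists (b.1, inv b.2 ** a.2); case: (vb) => li bL.
  have aL : a.2 \in L b.1 by rewrite ba; case: va.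
  have [_ LP _ kind] := HL li; have [_ _ bL'] := LP _ bL.
  split=> //=; last by apply; split=> //=; right; rewrite gE.
  case: kind => [fin|inf]; last by have [/negP[]] := inf _ _ bL' aL.
  move=> e [_ eL] ae [/= be _]; apply: ae; split; first by rewrite -be.
  by rewrite -ba; apply: fin => //; rewrite be.
(* The collapsed word would be a second reduced word for [one], besides the empty one. *)
case=> // -[i h] w cw _ E; have [k [w' [rw E' _]]] := collapse cw.
have [w0 [_ _ uniq0]] := Hfree one.
have e0 := uniq0 [::] I erefl.
by have := uniq0 _ rw (etrans E' E); rewrite -e0.
Qed.

Let alphabet : seq syllable := [seq (i, h) | i <- iota 0 n, h <- L i].

Let alphabetP a : a \in alphabet <-> valid a.
Proof.
case: a => i h; split.
  by case/allpairsPdep=> j [k [+ kL [-> ->]]]; rewrite mem_iota.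
by move=> [/= li hL]; apply/allpairsPdep; exists i, h; rewrite mem_iota.
Qed.

(* [None] is a redundant letter for the identity: the alphabet has to be
   nonempty even when [G] is trivial. *)
Let Sigma : finType := option (seq_sub alphabet).
Let letter_val (a : option (seq_sub alphabet)) : G := if a is Some l then (ssval l).2 else one.
Let pi (w : seq Sigma) : G := foldr (fun a g => letter_val a ** g) one w.

Let pi_cat u v : pi (u ++ v) = pi u ** pi v.
Proof. by elim: u => [|a u IH] /=; rewrite ?IH !gE. Qed.

Let T := short_rules pi.
Let TP l r : (l, r) \in T <-> [/\ size l <= 2, size r < size l & pi l = pi r].
Proof. exact: mem_short_rules. Qed.

Let T_reducing : length_reducing T.
Proof. by move=> l r /TP[]. Qed.

Let rconv_pi u v : rconv T u v -> pi u = pi v.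
Proof.
have step x y : rstep T x y -> pi x = pi y.
  by move=> [s [t [l [r [/TP[_ _ E] [-> ->]]]]]]; rewrite !pi_cat E.
by elim=> // [x y z /step -> _ ->|x y z /step -> _ ->].
Qed.

(** The letter [None] rewrites to the empty word, and a mergeable pair to the empty word or to one
    letter. *)
Let irreducible_letters w : irreducible T w -> exists v : seq (seq_sub alphabet),
  [/\ w = [seq Some l | l <- v], chain valid ok [seq ssval l | l <- v] &
      prod [seq ssval l | l <- v] = pi w].
Proof.
elim: w => [|a w IH] iw; first by exists [::].
have iw' : irreducible T w.
  move=> y [s [t [l [r [lr [e _]]]]]].
  by apply: (iw (a :: s ++ r ++ t)); exists (a :: s), t, l, r; rewrite e.
have [v [e cv Ev]] := IH iw'; subst w.
have nstep l r t : (l, r) \in T -> a :: [seq Some l | l <- v] = l ++ t -> False.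
  by move=> lr E; apply: (iw (r ++ t)); exists [::], t, l, r.
case: a iw nstep => [a|] iw nstep; last first.
  by case: (nstep [:: None] [::] [seq Some l | l <- v]) => //; apply/TP; rewrite /= gE.
exists (a :: v); split=> //=; last by rewrite Ev.
split=> //; first exact/alphabetP/ssvalP.
case: v {IH cv Ev iw'} iw nstep => // b v iw nstep [ab [m|m]].
  by case: (nstep [:: Some a; Some b] [::] [seq Some l | l <- v]) => //; apply/TP; rewrite /= !gE.
have cA : (((ssval a).1, (ssval a).2 ** (ssval b).2) : syllable) \in alphabet.
  by apply/alphabetP; split=> //=; case/alphabetP: (ssvalP a).
case: (nstep [:: Some a; Some b] [:: Some (SeqSub cA)] [seq Some l | l <- v]) => //.
by apply/TP; rewrite /= !gE.
Qed.

Let irreducible_pi u v : irreducible T u -> irreducible T v -> pi u = pi v -> u = v.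
Proof.
move=> /irreducible_letters[u' [-> cu Eu]] /irreducible_letters[v' [-> cv Ev]] E.
congr map; apply: (inj_map (@val_inj _ _ (seq_sub alphabet))).
by apply: letters_unique; rewrite // Eu Ev.
Qed.

Let pi_onto g : exists w, pi w = g.
Proof.
have syllable_word i h : i < n -> H i h -> exists w, pi w = h.
  move=> li Hh; have [_ _ gen _] := HL li; have [s [sL <-]] := gen h Hh.
  elim: s sL => [|k s IH] sL; first by exists [::].
  have [|w E] := IH; first by move=> x xs; apply: sL; rewrite inE xs orbT.
  have kA : ((i, k) : syllable) \in alphabet.
    by apply/alphabetP; split=> //=; apply: sL; rewrite mem_head.
  by exists (Some (SeqSub kA) :: w); rewrite /= E.
have [w [rw <- _]] := Hfree g.
elim: w rw => [|[i h] w IH] /=; first by exists [::].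
move=> [li Hh _ _ /IH[v <-]]; have [u <-] := syllable_word i h li Hh.
by exists (u ++ v); rewrite pi_cat.
Qed.

Let pi_rconv u v : pi u = pi v -> rconv T u v.
Proof.
have [u' uu iu] := rstar_irreducible T_reducing u.
have [v' vv iv] := rstar_irreducible T_reducing v.
have [cu cv] := (rstar_rconv uu, rstar_rconv vv).
rewrite (rconv_pi cu) (rconv_pi cv) => /(irreducible_pi iu iv) e; subst v'.
exact: rconv_trans cu (rconv_sym cv).
Qed.

Lemma letters_presentation : admits_fclr3_presentation mul one.
Proof.
exists Sigma, T, pi; split=> //.
- split; first by rewrite card_option.
  split; [by []|exact: pi_cat|exact: pi_onto|move=> u v].
  by split; [exact: pi_rconv|exact: rconv_pi].
- move=> [a|]; last by exists None; rewrite /= !gE.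
  case/alphabetP: (ssvalP a) => li aL.
  have [_ LP _ _] := HL li; have [_ _ iL] := LP _ aL.
  have iA : (((ssval a).1, inv (ssval a).2) : syllable) \in alphabet by apply/alphabetP.
  by exists (Some (SeqSub iA)); rewrite /= !gE.
- by move=> l r /TP[l2 _ _]; apply: leq_trans l2 _.
split; first exact: length_reducing_terminating T_reducing.
(* Confluence: irreducible descendants of [x] and [y] have the same value in [G], hence coincide. *)
move=> w x y wx wy.
have [x' xx ix] := rstar_irreducible T_reducing x.
have [y' yy iy] := rstar_irreducible T_reducing y.
exists x'; split=> //; suff -> : x' = y' by [].
apply: irreducible_pi => //.
have e1 := rconv_pi (rstar_rconv (rstar_trans wx xx)).
by rewrite -e1; apply: rconv_pi; apply: rstar_rconv; apply: rstar_trans yy.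
Qed.
End PlainIsPresented.

Theorem theorem1 (G : Type) (mul : G -> G -> G) (one : G) (inv : G -> G)
  (HG : is_group mul one inv) :
  admits_fclr3_presentation mul one <-> plain mul one inv.
Proof.
split.
  move=> [Sigma [T [pi [[_ pres] Sinv Tred T3 [_ conf]]]]].
  have ex g : exists w, pi w = g /\ irreducible T w.
    have [_ _ onto ker] := pres; have [w wg] := onto g.
    have [z wz iz] := rstar_irreducible Tred w.
    by exists z; rewrite -wg; split=> //; apply/ker/rconv_sym/rstar_rconv.
  have [nf nfP] := choice ex; exact: presented_is_plain nfP.
move=> [n [H [kind free]]].
(* With the bound inside the existential, [choice] yields a total function, arbitrary from [n]
   on. *)
have ex i : exists L, i < n -> factor_letters mul one inv (H i) L.
  case: (ltnP i n) => [li|]; last by exists [::].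
  by case: (kind i li) => [/(finite_letters HG)|/(cyclic_letters HG)] [L HL]; exists L.
have [L HL] := choice ex; exact: letters_presentation HL.
Qed.
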